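(* Let $N$ be a group of pseudo$H$-type with Lie algebra $\mathfrak n=\mathfrak z\oplus\mathfrak v$, and let $\gamma$ be a geodesic of $N$ with $\gamma(0)=1$ and $\dot\gamma(0)=z_0+x_0$, where $z_0\in\mathfrak z$, $x_0\in\mathfrak v$ and $z_0\neq 0\neq x_0$; if $\gamma$ is not null, it is normalized so that $\langle\dot\gamma,\dot\gamma\rangle=\pm1$. Let $\mathbb Z^*$ denote the set of all integers with $0$ removed, and let $t_0\neq 0$. 1. If $\langle z_0,z_0\rangle=\alpha^2$ with $\alpha>0$, then $\gamma(t_0)$ is conjugate to $\gamma(0)$ along $\gamma$ if and only if $$t_0\in\frac{2\pi}{\alpha}\mathbb Z^*\cup\mathbb A_1\cup\mathbb A_2,$$ where $$\mathbb A_1=\Bigl\{t\in\mathbb R\;\Bigm|\;\langle x_0,x_0\rangle\,\frac{\alpha t}{2}\cot\frac{\alpha t}{2}=\langle\dot\gamma,\dot\gamma\rangle\Bigr\}$$ and $$\mathbb A_2=\Bigl\{t\in\mathbb R\;\Bigm|\;\alpha t=\frac{\langle x_0,x_0\rangle}{\langle\dot\gamma,\dot\gamma\rangle+\langle z_0,z_0\rangle}\,\sin\alpha t\Bigr\}\quad\text{when }\dim\mathfrak z\ge 2$$ (so that $\mathbb A_2$ is omitted when $\dim\mathfrak z=1$). If $t_0\in\frac{2\pi}{\alpha}\mathbb Z^*$, then $$\operatorname{mult}_{cp}(t_0)=\begin{cases}\dim\mathfrak v-1 & \text{if }\langle\dot\gamma,\dot\gamma\rangle+\langle z_0,z_0\rangle\neq0,\\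 \dim\mathfrak n-2 & \text{if }\langle\dot\gamma,\dot\gamma\rangle+\langle z_0,z_0\rangle=0.\end{cases}$$ If $t_0\notin\frac{2\pi}{\alpha}\mathbb Z^*$, then $$\operatorname{mult}_{cp}(t_0)=\begin{cases}1 & \text{if }t_0\in\mathbb A_1-\mathbb A_2,\\ \dim\mathfrak z-1 & \text{if }t_0\in\mathbb A_2-\mathbb A_1,\\ \dim\mathfrak z & \text{if }t_0\in\mathbb A_1\cap\mathbb A_2.\end{cases}$$ 2. If $\langle z_0,z_0\rangle=-\beta^2$ with $\beta>0$, then $\gamma(t_0)$ is a conjugate point along $\gamma$ (that is, conjugate to $\gamma(0)$) if and only if $t_0\in\mathbb B_1\cup\mathbb B_2$, where $$\mathbb B_1=\Bigl\{t\in\mathbb R\;\Bigm|\;\langle x_0,x_0\rangle\,\frac{\beta t}{2}\coth\frac{\beta t}{2}=\langle\dot\gamma,\dot\gamma\rangle\Bigr\}$$ and $$\mathbb B_2=\Bigl\{t\in\mathbb R\;\Bigm|\;\beta t=\frac{\langle x_0,x_0\rangle}{\langle\dot\gamma,\dot\gamma\rangle+\langle z_0,z_0\rangle}\,\sinh\beta t\Bigr\}\quad\text{when }\dim\mathfrak z\ge2$$ (so that $\mathbb B_2$ is omitted when $\dim\mathfrak z=1$). The multiplicity is $$\operatorname{mult}_{cp}(t_0)=\begin{cases}1 & \text{if }t_0\in\mathbb B_1-\mathbb B_2,\\ \dim\mathfrak z-1 & \text{if }t_0\in\mathbb B_2-\mathbb B_1,\\ \dim\mathfrak z & \text{if }t_0\in\mathbb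 B_1\cap\mathbb B_2.\end{cases}$$ 3. If $\langle z_0,z_0\rangle=0$, then $\gamma(t_0)$ is a conjugate point along $\gamma$ (that is, conjugate to $\gamma(0)$) if and only if $$t_0^2=-\frac{12}{\langle x_0,x_0\rangle},$$ and $\operatorname{mult}_{cp}(t_0)=\dim\mathfrak z-1$.
   Context: An inner product on a real vector space means a nondegenerate symmetric bilinear form, not necessarily definite. $N$ is a connected 2-step nilpotent Lie group with Lie algebra $\mathfrak n$ having center $\mathfrak z$; $\langle\,,\rangle$ denotes an inner product on $\mathfrak n$ and also the induced left-invariant pseudoriemannian metric tensor on $N$. It is assumed throughout that $\mathfrak z$ is nondegenerate with respect to $\langle\,,\rangle$; put $\mathfrak v=\mathfrak z^\perp$, so $\mathfrak n=\mathfrak z\oplus\mathfrak v$. For $z\in\mathfrak z$, the operator $J_z:\mathfrak v\to\mathfrak v$ is defined by $\langle J_z x,y\rangle=\langle z,[x,y]\rangle$ for $x,y\in\mathfrak v$ (i.e. $J_zx=\operatorname{ad}_x^{\dagger}z$, the adjoint taken with respect to $\langle\,,\rangle$). $N$ is of pseudo$H$-type if and only if $J_z^2=-\langle z,z\rangle I$ for every $z\in\mathfrak z$. A geodesic $\gamma$ is null if $\langle\dot\gamma,\dot\gamma\rangle=0$; $\langle\dot\gamma,\dot\gamma\rangle$ is constant along $\gamma$. A Jacobi field along $\gamma$ is a vector field $Y$ along $\gamma$ with $\nabla_{\dot\gamma}^2Y+R(Y,\dot\gamma)\dot\gamma=0$, where $\nabla$ is the Levi-Civita connection and $R$ its curvature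 tensor (with the sign convention that makes this the usual Jacobi equation). The point $\gamma(t_0)$ is conjugate to $\gamma(0)$ along $\gamma$ if and only if there is a nontrivial Jacobi field $Y$ along $\gamma$ with $Y(0)=Y(t_0)=0$; $\operatorname{mult}_{cp}(t_0)$ denotes the multiplicity of the conjugate point $\gamma(t_0)$, i.e. the dimension of the space of Jacobi fields along $\gamma$ vanishing at both $0$ and $t_0$.
   Formalization: When ⟨γ̇,γ̇⟩+⟨z0,z0⟩=0 the quotient in A2 and B2 is undefined; there the equation is read with the denominator cleared, i.e. ⟨x0,x0⟩ sin αt = 0 (resp. ⟨x0,x0⟩ sinh βt = 0), without which part 1 fails, e.g. at t0 = π/α. *)

(* Defs.v *)
From HB Require Import structures.
From mathcomp Require Import all_boot all_order all_algebra.
From mathcomp Require Import all_classical all_reals all_analysis.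
Set Implicit Arguments.
Unset Strict Implicit.
Unset Printing Implicit Defensive.
Import Order.TTheory GRing.Theory Num.Theory.
Import numFieldNormedType.Exports.
Local Open Scope classical_set_scope.
Local Open Scope ring_scope.

(* The Lie algebra is carried by V = 'rV[R]_n with an arbitrary bilinear
   bracket, that is, an arbitrary n-dimensional real Lie algebra in which a
   basis has been chosen; the norm of 'rV[R]_n only serves to differentiate
   curves. *)
Section PseudoRiemannianNilpotentGroup.
Variables (R : realType) (n : nat).
Local Notation V := 'rV[R]_n.
Implicit Types (br : {bilinear V -> V -> V}) (ip : {biscalar V})
  (zz vv : {vspace V}).

Definition lie_bracket br : Prop :=
  (forall x, br x x = 0) /\
  (forall x y w, br x (br y w) + br y (br w x) + br w (br x y) = 0).

Definition two_step_nilpotent br : Prop :=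
  (forall x y w, br x (br y w) = 0) /\ (exists x y, br x y != 0).

Definition center_of br zz : Prop :=
  forall x, x \in zz <-> (forall y, br x y = 0).

Definition inner_product ip : Prop :=
  (forall x y, ip x y = ip y x) /\
  (forall x, (forall y, ip x y = 0) -> x = 0).

Definition nondegenerate_on ip zz : Prop :=
  forall x, x \in zz -> (forall y, y \in zz -> ip x y = 0) -> x = 0.

Definition orthogonal_complement ip zz vv : Prop :=
  forall x, x \in vv <-> (forall w, w \in zz -> ip w x = 0).

(* [J w] matters only on vv, for w in zz: there it is the adjoint operator
   J_w : vv -> vv. *)
Definition J_operator br ip zz vv (J : V -> V -> V) : Prop :=
  forall w x, w \in zz -> x \in vv ->
    J w x \in vv /\ (forall y, y \in vv -> ip (J w x) y = ip w (br x y)).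

Definition pseudoH_type br ip zz vv : Prop :=
  exists J, J_operator br ip zz vv J /\
    (forall w x, w \in zz -> x \in vv -> J w (J w x) = - ip w w *: x).

(* A connected 2-step nilpotent Lie group is the quotient of its Lie algebra,
   with the Campbell-Hausdorff product x + y + [x, y] / 2, by a discrete
   central subgroup, and its exponential map is the quotient map.  Conversely,
   a group [N] with a map [e] as below has a unique structure of Lie group for
   which [e] is its exponential map: the one making [e] a local
   diffeomorphism. *)
Definition exponential_map br (N : groupType) (e : V -> N) : Prop :=
  [/\ forall p, exists x, e x = p,
      forall x y, (e x * e y)%g = e (x + y + 2^-1 *: br x y) &
      exists2 r : R, 0 < r & forall x, `|x| < r -> e x = 1%g -> x = 0].

(* All tangent spaces of [N] are identified with V by left translations: a
   vector w in V stands at p for the vector dL_p(w).  The left-invariant metric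
   is then the constant [ip], and a vector field along a curve of [N] is a
   function R -> V.  [u] below is the velocity of the curve [gamma]: near each
   t, gamma (t + h) = gamma t * e (c h) with c 0 = 0 and c' 0 = u t. *)
Definition velocity (N : groupType) (e : V -> N) (gamma : R -> N)
    (u : R -> V) : Prop :=
  forall t, exists c : R -> V,
    [/\ \forall h \near (0 : R), gamma (t + h) = (gamma t * e (c h))%g,
        c 0 = 0 & is_derive (0 : R) (1 : R) c (u t)].

(* [nabla x y] is the covariant derivative of the left-invariant vector field
   y in the direction of the left-invariant vector field x: these are the
   torsion-free and metric conditions on left-invariant fields, where inner
   products are constant. *)
Definition levi_civita br ip (nabla : {bilinear V -> V -> V}) : Prop :=
  (forall x y, nabla x y - nabla y x = br x y) /\
  (forall x y w, ip (nabla x y) w + ip y (nabla x w) = 0).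

Definition curvature br (nabla : V -> V -> V) (x y w : V) : V :=
  nabla x (nabla y w) - nabla y (nabla x w) - nabla (br x y) w.

Definition covariant_derivative (nabla : V -> V -> V) (u Y : R -> V) : R -> V :=
  fun t => 'D_1 Y t + nabla (u t) (Y t).

Definition differentiable_field (Y : R -> V) : Prop :=
  forall t : R, derivable Y t 1.

Definition geodesic (nabla : V -> V -> V) (N : groupType) (e : V -> N)
    (gamma : R -> N) (u : R -> V) : Prop :=
  [/\ velocity e gamma u, differentiable_field u &
      forall t, covariant_derivative nabla u u t = 0].

Definition jacobi_field br (nabla : V -> V -> V) (u Y : R -> V) : Prop :=
  let DY := covariant_derivative nabla u Y in
  [/\ differentiable_field Y, differentiable_field DY &
      forall t, covariant_derivative nabla u DY t
                + curvature br nabla (Y t) (u t) (u t) = 0].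

Definition vanishing_jacobi_field br nabla (u : R -> V) (t0 : R)
    (Y : R -> V) : Prop :=
  [/\ jacobi_field br nabla u Y, Y 0 = 0 & Y t0 = 0].

Definition conjugate_point br nabla (u : R -> V) (t0 : R) : Prop :=
  exists Y, vanishing_jacobi_field br nabla u t0 Y /\ exists t, Y t != 0.

(* The set P is a k-dimensional linear subspace of E. *)
Definition has_dimension (E : lmodType R) (P : E -> Prop) (k : nat) : Prop :=
  exists b : 'I_k -> E,
    (forall c : 'rV[R]_k, P (\sum_i c 0 i *: b i)) /\
    (forall f, P f -> exists! c : 'rV[R]_k, f = \sum_i c 0 i *: b i).

Definition mult_cp br nabla (u : R -> V) (t0 : R) (k : nat) : Prop :=
  has_dimension (vanishing_jacobi_field br nabla u t0) k.

End PseudoRiemannianNilpotentGroup.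

Section ConjugateParameters.
Variable R : realType.
Implicit Types a p g d : R.

Definition cot (x : R) : R := cos x / sin x.
Definition sinh (x : R) : R := (expR x - expR (- x)) / 2.
Definition cosh (x : R) : R := (expR x + expR (- x)) / 2.
Definition coth (x : R) : R := cosh x / sinh x.

Definition nonzero_multiples a : set R :=
  [set a * k%:~R | k in [set k : int | k != 0]].

(* The equation s = (p / d) * f.  When d = 0 it is read with its denominator
   cleared, d * s = p * f, that is p * f = 0. *)
Definition eq_ratio (s p d f : R) : Prop :=
  if d == 0 then p * f = 0 else s = p / d * f.

(* Below, p stands for <x0, x0>, g for <gamma', gamma'>, d for
   <gamma', gamma'> + <z0, z0> and m for the dimension of the center. *)
Definition A1 a p g : set R :=
  [set t | sin (a * t / 2) != 0 /\ p * (a * t / 2 * cot (a * t / 2)) = g].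

Definition A2 (m : nat) a p d : set R :=
  [set t | (2 <= m)%N /\ eq_ratio (a * t) p d (sin (a * t))].

Definition B1 a p g : set R :=
  [set t | sinh (a * t / 2) != 0 /\ p * (a * t / 2 * coth (a * t / 2)) = g].

Definition B2 (m : nat) a p d : set R :=
  [set t | (2 <= m)%N /\ eq_ratio (a * t) p d (sinh (a * t))].

End ConjugateParameters.

(* Main.v *)
Require Import Defs.
From HB Require Import structures.
From mathcomp Require Import all_boot all_order all_algebra.
From mathcomp Require Import all_classical all_reals all_analysis.
From mathcomp Require Import ring lra.
Set Implicit Arguments.
Unset Strict Implicit.
Unset Printing Implicit Defensive.
Import Order.TTheory GRing.Theory Num.Theory.
Import numFieldNormedType.Exports.
Local Open Scope classical_set_scope.
Local Open Scope ring_scope.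

(* Write [u = z + x] for the velocity in left trivialization, and let [X] be the
   variation of [u] induced by a variation field [Y].  The Jacobi equation is
   equivalent to [Y' = X - [u, Y]], [X' = - nabla_X u - nabla_u X].  For a
   pseudoH-type algebra this system is explicitly solvable: [u = z0 + exp(tJ) x0]
   with [J = J_z0], [J^2 = - lam], [lam = <z0, z0>], the central part [zeta] of
   [X] is constant, and the Clifford relations give
   [J_zeta exp(tJ) x0 = exp(-tJ) J_zeta x0 - 2 <zeta, z0> S x0].  So the Jacobi
   fields vanishing at 0 form an explicit family indexed by [X 0], and those
   vanishing at [T] are given by a linear system.  Away from the periods of
   [exp(tJ)] its orthogonal part determines the non-central component of [X 0],
   and its central part becomes
   [(T + p F / 2) zeta = p kappa <zeta, z0> z0],  [p = <x0, x0>],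
   whose coefficients on the orthogonal of [z0] and along [z0] vanish on the sets
   A2 (B2) and A1 (B1).  At a period it says [<zeta, z0> = 0],
   [<X 0, x0> = 0] and [(p + 2 lam) zeta = 0]. *)

(** * Differentiation of vector-valued curves *)

Section RowCalculus.
Variables (R : realType) (n : nat).
Local Notation V := 'rV[R]_n.

Lemma is_derive_rowP (f : R -> V) (t : R) (df : V) :
  is_derive t 1 f df <->
  (forall j, is_derive t 1 (fun x => f x 0 j) (df 0 j)).
Proof.
split=> [[fd <-] j|fd].
  have fj : derivable (fun x => f x 0 j) t 1 by move/derivable_mxP: fd; exact.
  by apply: DeriveDef => //; rewrite derive_mx// mxE.
have fd' : derivable f t 1.
  by apply/derivable_mxP => i j; rewrite ord1; have [] := fd j.
apply: DeriveDef => //; rewrite derive_mx//.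
by apply/rowP => j; rewrite mxE; have [] := fd j.
Qed.

Lemma is_derive_scale (f : R -> R) (g : R -> V) (t df : R) (dg : V) :
  is_derive t 1 f df -> is_derive t 1 g dg ->
  is_derive t 1 (fun x => f x *: g x) (df *: g t + f t *: dg).
Proof.
move=> fd /is_derive_rowP gd; apply/is_derive_rowP => j.
have -> : (fun x => (f x *: g x) 0 j) = f * (fun x => g x 0 j).
  by apply/funext => x; rewrite mxE.
apply: (is_derive_eq (is_deriveM fd (gd j))).
by rewrite !mxE addrC; congr (_ + _); rewrite mulrC.
Qed.

Lemma is_derive_scalel (f : R -> R) (v : V) (t df : R) :
  is_derive t 1 f df -> is_derive t 1 (fun x => f x *: v) (df *: v).
Proof.
move=> fd; apply: is_derive_eq.
  exact: (is_derive_scale fd (is_derive_cst v t 1)).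
by rewrite scaler0 addr0.
Qed.

Lemma is_derive_coord (g : R -> V) (t : R) (dg : V) j :
  is_derive t 1 g dg -> is_derive t 1 (fun x => g x 0 j) (dg 0 j).
Proof. by move=> /is_derive_rowP. Qed.

(** Expanding one argument at a time in the basis [delta_mx 0 i] leaves only products of a scalar
    function with a vector-valued one. *)
Lemma is_derive_bilinear (B : {bilinear V -> V -> V}) (f g : R -> V)
    (t : R) (df dg : V) :
  is_derive t 1 f df -> is_derive t 1 g dg ->
  is_derive t 1 (fun x => B (f x) (g x)) (B df (g t) + B (f t) dg).
Proof.
move=> fd /is_derive_rowP gd.
have Br (v w : V) : B v w = \sum_i w 0 i *: B v (delta_mx 0 i).
  by rewrite {1}[w]row_sum_delta linear_sum; apply: eq_bigr => i _;
     rewrite linearZ.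
have Bl (w v : V) : B v w = \sum_i v 0 i *: B (delta_mx 0 i) w.
  by rewrite {1}[v]row_sum_delta -[LHS]/(applyr B w _) linear_sum; apply: eq_bigr => i _;
     rewrite /= linearZl_LR.
have fB w : is_derive t 1 (fun x => B (f x) w) (B df w).
  have -> : (fun x => B (f x) w) =
      \sum_i (fun x => f x 0 i *: B (delta_mx 0 i) w).
    by apply/funext => x; rewrite fct_sumE Bl.
  rewrite Bl; apply: is_derive_sum => i.
  by apply: is_derive_scalel; apply: is_derive_coord.
have -> : (fun x => B (f x) (g x)) =
    \sum_i (fun x => g x 0 i *: B (f x) (delta_mx 0 i)).
  by apply/funext => x; rewrite fct_sumE Br.
rewrite (Br df) (Br (f t) dg) -big_split /=.
apply: is_derive_sum => i.
rewrite addrC; exact: is_derive_scale (fB _).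
Qed.

Lemma is_derive_linear (L : {linear V -> V}) (f : R -> V) (t : R) (df : V) :
  is_derive t 1 f df -> is_derive t 1 (fun x => L (f x)) (L df).
Proof.
move=> fd.
have Ls (v : V) : L v = \sum_i v 0 i *: L (delta_mx 0 i).
  by rewrite {1}[v]row_sum_delta linear_sum; apply: eq_bigr => i _;
     rewrite linearZ.
have -> : (fun x => L (f x)) = \sum_i (fun x => f x 0 i *: L (delta_mx 0 i)).
  by apply/funext => x; rewrite fct_sumE Ls.
rewrite Ls; apply: is_derive_sum => i.
by apply: is_derive_scalel; apply: is_derive_coord.
Qed.

Lemma is_derive_lfun (L : 'End(V)) (f : R -> V) (t : R) (df : V) :
  is_derive t 1 f df -> is_derive t 1 (fun x => L (f x)) (L df).
Proof. exact: is_derive_linear. Qed.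

Lemma is_derive_bilinearr (B : {bilinear V -> V -> V}) v (f : R -> V)
    (t : R) (df : V) :
  is_derive t 1 f df -> is_derive t 1 (fun x => B v (f x)) (B v df).
Proof. exact: is_derive_linear. Qed.

Lemma is_derive0_cst (f : R -> V) :
  (forall t : R, is_derive t 1 f 0) -> forall t, f t = f 0.
Proof.
move=> fd t; apply/rowP => j.
apply: (@is_derive_0_is_cst _ (fun x => f x 0 j)) => x.
by have /is_derive_rowP/(_ j) := fd x; rewrite mxE.
Qed.

Lemma is_deriveD_fun (W : normedModType R) (f g : R -> W) (t : R) (df dg : W) :
  is_derive t 1 f df -> is_derive t 1 g dg ->
  is_derive t 1 (fun x => f x + g x) (df + dg).
Proof. exact: is_deriveD. Qed.

Lemma is_deriveB_fun (W : normedModType R) (f g : R -> W) (t : R) (df dg : W) :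
  is_derive t 1 f df -> is_derive t 1 g dg ->
  is_derive t 1 (fun x => f x - g x) (df - dg).
Proof. exact: is_deriveB. Qed.

End RowCalculus.

(** * Hyperplanes cut out by linear forms *)

Section LinearForms.
Variables (F : fieldType) (vT : vectType F).

(** Rank-nullity: a form that is nonzero somewhere on [U] maps [U] onto the line. The dimensions
    [\dim zz - 1], [\dim vv - 1] and [n - 2] are all counted in this way. *)
Lemma form_kernel (f : vT -> F) (U : {vspace vT}) :
  (forall a x y, f (a *: x + y) = a * f x + f y) ->
  exists W : {vspace vT}, (forall x, x \in W <-> x \in U /\ f x = 0) /\
    (forall x, x \in U -> f x != 0 -> \dim W = (\dim U - 1)%N).
Proof.
move=> f_lin.
pose fL : {linear vT -> F^o} :=
  HB.pack (f : vT -> F^o) (GRing.isLinear.Build _ _ _ _ (f : vT -> F^o) f_lin).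
pose g := linfun fL; have gE x : g x = f x by rewrite lfunE.
exists (U :&: lker g)%VS; split=> [x|x xU fx0].
  rewrite memv_cap memv_ker gE.
  by split=> [/andP[-> /eqP ->]|[-> ->]]; rewrite ?eqxx.
suff dimg : \dim (g @: U) = 1%N by rewrite -(limg_ker_dim g U) dimg addnK.
apply/eqP; rewrite eqn_leq; apply/andP; split.
  by rewrite (leq_trans (dimvS (subvf _)))// dimvf.
rewrite lt0n dimv_eq0; apply: contra fx0 => /eqP gU0.
by have := memv_img g xU; rewrite gU0 memv0 gE.
Qed.

End LinearForms.

(** * Algebra of pseudoH-type *)

Record pseudoH_algebra (R : realType) (n : nat)
    (br : {bilinear 'rV[R]_n -> 'rV[R]_n -> 'rV[R]_n}) (ip : {biscalar 'rV[R]_n})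
    (zz vv : {vspace 'rV[R]_n})
    (nabla : {bilinear 'rV[R]_n -> 'rV[R]_n -> 'rV[R]_n}) : Prop :=
  PseudoHAlgebra {
    ph_lie : lie_bracket br;
    ph_nil : two_step_nilpotent br;
    ph_center : center_of br zz;
    ph_inner : inner_product ip;
    ph_nondeg : nondegenerate_on ip zz;
    ph_orth : orthogonal_complement ip zz vv;
    ph_type : pseudoH_type br ip zz vv;
    ph_LC : levi_civita br ip nabla
  }.

Section PseudoHTypeAlgebra.
Variables (R : realType) (n : nat).
Local Notation V := 'rV[R]_n.
Variables (br : {bilinear V -> V -> V}) (ip : {biscalar V})
  (zz vv : {vspace V}) (nabla : {bilinear V -> V -> V}).
Hypothesis ph : pseudoH_algebra br ip zz vv nabla.
Implicit Types (x y w : V) (z : V).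

Lemma bracketC x y : br x y = - br y x.
Proof.
apply/eqP; rewrite -addr_eq0 -((ph_lie ph).1 (x + y)).
by rewrite linearDr !linearDl !(ph_lie ph).1 add0r addr0 addrC.
Qed.

Lemma bracket_centerl z x : z \in zz -> br z x = 0.
Proof. by move=> /(ph_center ph). Qed.

Lemma bracket_centerr z x : z \in zz -> br x z = 0.
Proof. by move=> zzz; rewrite bracketC bracket_centerl ?oppr0. Qed.

Lemma bracket_in_center x y : br x y \in zz.
Proof. by apply/(ph_center ph) => w; rewrite bracketC (ph_nil ph).1 oppr0. Qed.

Lemma ipC x y : ip x y = ip y x.
Proof. exact: (ph_inner ph).1. Qed.

Lemma ip_center_orth z x : z \in zz -> x \in vv -> ip z x = 0.
Proof. by move=> zzz /(ph_orth ph); apply. Qed.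

Lemma ip_orth_center z x : z \in zz -> x \in vv -> ip x z = 0.
Proof. by move=> zzz xvv; rewrite ipC ip_center_orth. Qed.

Lemma center_cap_orth : (zz :&: vv = 0)%VS.
Proof.
apply/eqP; rewrite -subv0; apply/subvP => x /memv_capP[xz /(ph_orth ph) xv].
by rewrite memv0; apply/eqP; apply: (ph_nondeg ph) => // y /xv; rewrite ipC.
Qed.

(** The Gram map, which pairs a vector with a basis of [zz], has kernel [vv] and rank at most
    [\dim zz]. So the dimensions of [zz] and [vv] add up to at least [n], while their intersection
    is trivial. *)
Lemma center_add_orth : (zz + vv = fullv)%VS.
Proof.
pose gram (x : V) : 'rV[R]_(\dim zz) := \row_i ip (vbasis zz)`_i x.
have gram_lin : linear gram.
  by move=> a x y; apply/rowP => i; rewrite !mxE linearP.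
pose gramL : {linear V -> 'rV[R]_(\dim zz)} :=
  HB.pack gram (GRing.isLinear.Build _ _ _ _ gram gram_lin).
have kerE : lker (linfun gramL) = vv.
  apply/vspaceP => x; rewrite memv_ker lfunE /=; apply/eqP/idP => [g0|/(ph_orth ph) xv].
    apply/(ph_orth ph) => w /coord_vbasis ->.
    rewrite -[LHS]/(applyr ip x _) linear_sum big1// => i _ /=.
    rewrite linearZl_LR /=; move/rowP: g0 => /(_ i); rewrite !mxE => ->.
    exact: mulr0.
  apply/rowP => i; rewrite !mxE xv// vbasis_mem// mem_nth//.
  by rewrite size_tuple.
apply/eqP; rewrite eqEdim subvf /= dimv_disjoint_sum ?center_cap_orth//.
rewrite -(limg_ker_dim (linfun gramL) fullv) capfv kerE addnC leq_add2r.
by rewrite (leq_trans (dimvS (subvf _)))// dimvf /dim /= mul1n.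
Qed.

Definition cproj : 'End(V) := daddv_pi zz vv.
Definition oproj : 'End(V) := daddv_pi vv zz.

Lemma cproj_in x : cproj x \in zz. Proof. exact: memv_pi. Qed.
Lemma oproj_in x : oproj x \in vv. Proof. exact: memv_pi. Qed.

Lemma cproj_oproj x : cproj x + oproj x = x.
Proof.
by apply: daddv_pi_add; rewrite ?center_cap_orth// center_add_orth memvf.
Qed.

Lemma cproj_id z : z \in zz -> cproj z = z.
Proof. by apply: daddv_pi_id; rewrite center_cap_orth. Qed.

Lemma oproj_id x : x \in vv -> oproj x = x.
Proof. by apply: daddv_pi_id; rewrite capvC center_cap_orth. Qed.

Lemma oproj_center z : z \in zz -> oproj z = 0.
Proof.
by move=> zzz; apply: (addrI (cproj z)); rewrite cproj_oproj cproj_id ?addr0.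
Qed.

Lemma cproj_orth x : x \in vv -> cproj x = 0.
Proof.
by move=> xv; apply: (addIr (oproj x)); rewrite cproj_oproj oproj_id ?add0r.
Qed.

Lemma center_eq0 z : z \in zz -> (forall w, w \in zz -> ip w z = 0) -> z = 0.
Proof. by move=> zz_z z0; apply: (ph_nondeg ph) => // w wz; rewrite ipC z0. Qed.

Lemma orth_eq0 x : x \in vv -> (forall y, y \in vv -> ip x y = 0) -> x = 0.
Proof.
move=> xv x0; apply: (ph_inner ph).2 => y; rewrite -(cproj_oproj y) linearDr.
by rewrite ip_orth_center ?cproj_in// x0 ?addr0 ?oproj_in.
Qed.

Lemma orthP x : (forall z, z \in zz -> ip x z = 0) -> x \in vv.
Proof. by move=> xz; apply/(ph_orth ph) => z zzz; rewrite ipC xz. Qed.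

(** Inner products of left-invariant fields are constant, so the derivative terms of the usual
    Koszul formula disappear. The rest combines the metric conditions for the cyclic permutations of
    [x], [y], [w]. *)
Lemma koszul x y w :
  2 * ip (nabla x y) w = ip (br x y) w - ip (br y w) x + ip (br w x) y.
Proof.
rewrite -!(ph_LC ph).1 !linearBl.
have a1 := (ph_LC ph).2 x y w; have a2 := (ph_LC ph).2 y w x.
have a3 := (ph_LC ph).2 w x y.
rewrite (ipC y) in a1; rewrite (ipC w) in a2; rewrite (ipC x) in a3.
by lra.
Qed.

Lemma nabla_center z w : z \in zz -> w \in zz -> nabla z w = 0.
Proof.
move=> zz_z zz_w; apply: (ph_inner ph).2 => y.
have := koszul z w y.
rewrite (bracket_centerl _ zz_z) (bracket_centerl _ zz_w).
rewrite (bracket_centerr _ zz_z) !linear0l.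
by rewrite subrr addr0 => /eqP; rewrite mulf_eq0 pnatr_eq0 => /eqP.
Qed.

Lemma nabla_centerl z x : z \in zz -> nabla z x = nabla x z.
Proof.
by move=> zz_z; apply/eqP; rewrite -subr_eq0 (ph_LC ph).1 bracket_centerl.
Qed.

(** The other two Koszul terms pair a bracket, which is central, with a vector of [vv]. *)
Lemma nabla_orth x y : x \in vv -> y \in vv -> nabla x y = 2^-1 *: br x y.
Proof.
move=> xv yv; apply/eqP; rewrite -subr_eq0; apply/eqP/(ph_inner ph).2 => w.
have := koszul x y w.
rewrite (ip_center_orth (bracket_in_center y w) xv).
rewrite (ip_center_orth (bracket_in_center w x) yv) addr0 subr0.
rewrite linearBl linearZl_LR /=.
by lra.
Qed.

(* The Levi-Civita connection satisfies [nabla x z = - J z x / 2], which yields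
   the operators [J z] as a bilinear map on the whole Lie algebra.  It is locked
   so that the rewriting rules for scaling do not see through it. *)
Definition Jmap z x : V := locked (- 2%:R *: nabla x z).

Lemma Jmap_bilinear : bilinear_for *:%R *:%R Jmap.
Proof.
split=> [x a y w|x a y w]; rewrite /Jmap -lock -!lock.
  by rewrite linearDr linearZ/= scalerDr !scalerA mulrC.
by rewrite linearDl linearZl_LR/= scalerDr !scalerA mulrC.
Qed.
HB.instance Definition _ := bilinear_isBilinear.Build R V V V _ _ Jmap
  Jmap_bilinear.

Local Notation J := Jmap.

Lemma nabla_orth_center z x : nabla x z = - 2^-1 *: J z x.
Proof. by rewrite /Jmap -lock scalerA mulrNN mulVf ?pnatr_eq0// scale1r. Qed.

Lemma ip_J z x y : z \in zz -> ip (J z x) y = ip z (br x y).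
Proof.
move=> zz_z; rewrite /Jmap -lock linearZl_LR /= mulNr koszul (bracketC y).
rewrite (bracket_centerr _ zz_z) (bracket_centerl _ zz_z) !linear0l linearNl.
by rewrite (ipC z) subr0 add0r opprK.
Qed.

Lemma J_in z x : z \in zz -> J z x \in vv.
Proof.
move=> zz_z; apply: orthP => w zz_w.
by rewrite ip_J// bracket_centerr// linear0r.
Qed.

Lemma J_skew z x y : z \in zz -> ip (J z x) y = - ip x (J z y).
Proof.
by move=> zz_z; rewrite (ipC x) !ip_J// bracketC linearNr.
Qed.

(** The operator supplied by [pseudoH_type] agrees with [Jmap] on [zz] and [vv]: both satisfy the
    same adjoint identity, and [vv] is nondegenerate. *)
Lemma J_sqr z x : z \in zz -> x \in vv -> J z (J z x) = - ip z z *: x.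
Proof.
have [J0 [J0J J0_sqr]] := ph_type ph.
have JE w y : w \in zz -> y \in vv -> J0 w y = J w y.
  move=> zw yv; have [J0v J0ip] := J0J _ _ zw yv.
  apply/eqP; rewrite -subr_eq0; apply/eqP/orth_eq0.
    by rewrite rpredB ?J_in.
  by move=> y' y'v; rewrite linearBl /= J0ip// ip_J// subrr.
by move=> zz_z xv; rewrite -J0_sqr// !JE ?J_in.
Qed.

(** Polarization of [J_sqr] at [z + w]. *)
Lemma J_clifford z w x : z \in zz -> w \in zz -> x \in vv ->
  J z (J w x) = - J w (J z x) - (2 * ip z w) *: x.
Proof.
move=> zz_z zz_w xv.
have := J_sqr (rpredD zz_z zz_w) xv.
rewrite !(linearDl, linearDr) /= !J_sqr// (ipC w z) => /rowP JJ.
by apply/rowP => j; have := JJ j; rewrite !mxE; lra.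
Qed.

Lemma ip_J_same z w x : z \in zz -> w \in zz -> x \in vv ->
  ip (J z x) (J w x) = ip z w * ip x x.
Proof.
move=> zz_z zz_w xv.
have := congr1 (ip x) (J_clifford zz_z zz_w xv).
rewrite linearBr linearNr linearZr_LR /=.
have := J_skew x (J w x) zz_z; have := J_skew x (J z x) zz_w.
rewrite (ipC (J w x)); lra.
Qed.

Lemma ip_x_Jx z x : z \in zz -> ip x (J z x) = 0.
Proof. by move=> zz_z; have := J_skew x x zz_z; rewrite ipC; lra. Qed.

End PseudoHTypeAlgebra.

(** * Differentiation of scalar functions *)

Section ScalarDerivatives.
Variables (R : realType).
Implicit Types (f g : R -> R) (t df dg : R).

Lemma is_deriveM_fun f g t df dg : is_derive t 1 f df -> is_derive t 1 g dg ->
  is_derive t 1 (fun x => f x * g x) (df * g t + f t * dg).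
Proof.
move=> fd gd; apply: (is_derive_eq (is_deriveM fd gd)).
by rewrite addrC mulrC.
Qed.

Lemma is_derive_const (c t : R) : is_derive t 1 (fun=> c) (0 : R).
Proof. exact: is_derive_cst. Qed.

Lemma is_derive_arg t : is_derive t 1 (fun x : R => x) (1 : R).
Proof. exact: is_derive_id. Qed.

End ScalarDerivatives.

(** * Jacobi fields as perturbations of the geodesic flow *)

Section Perturbations.
Variables (R : realType) (n : nat).
Local Notation V := 'rV[R]_n.
Variables (br : {bilinear V -> V -> V}) (nabla : {bilinear V -> V -> V}).
Hypothesis torsion_free : forall x y, nabla x y - nabla y x = br x y.
Variable u : R -> V.
Hypothesis u_geod : forall t : R, is_derive t 1 u (- nabla (u t) (u t)).
Implicit Types X Y : R -> V.

(* [Y] is a variation field, in left trivialization, and [X] the corresponding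
   variation of the velocity: the equations say that [X] is the derivative of
   velocities and solves the linearized geodesic equation. *)
Definition perturbation Y X : Prop := forall t : R,
  is_derive t 1 Y (X t - br (u t) (Y t)) /\
  is_derive t 1 X (- nabla (X t) (u t) - nabla (u t) (X t)).

Lemma perturbationB Y1 X1 Y2 X2 : perturbation Y1 X1 -> perturbation Y2 X2 ->
  perturbation (fun t => Y1 t - Y2 t) (fun t => X1 t - X2 t).
Proof.
move=> P1 P2 t; have [dY1 dX1] := P1 t; have [dY2 dX2] := P2 t; split.
  apply: (is_derive_eq (is_deriveB_fun dY1 dY2)).
  by rewrite linearBr; apply/rowP => j; rewrite !mxE; ring.
apply: (is_derive_eq (is_deriveB_fun dX1 dX2)).
by rewrite linearBr linearBl; apply/rowP => j; rewrite !mxE; ring.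
Qed.

(** The covariant derivative of [Y] is [X + nabla Y u]. Once brackets are expressed through
    torsion-freeness, the Jacobi equation is a sum of iterated [nabla] terms that cancel. *)
Lemma perturbation_jacobi Y X : perturbation Y X ->
  jacobi_field br nabla u Y.
Proof.
move=> P.
have DYE : covariant_derivative nabla u Y = fun t => X t + nabla (Y t) (u t).
  apply/funext => t; have [[_ dY] _] := P t.
  rewrite /covariant_derivative dY -torsion_free.
  by apply/rowP => j; rewrite !mxE; ring.
have dDY (t : R) : is_derive t 1 (covariant_derivative nabla u Y)
   (- nabla (X t) (u t) - nabla (u t) (X t) +
   (nabla (X t - br (u t) (Y t)) (u t) - nabla (Y t) (nabla (u t) (u t)))).
  have [dY dX] := P t; rewrite DYE.
  apply: (is_derive_eq (is_deriveD_fun dX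
    (is_derive_bilinear nabla dY (u_geod t)))).
  by rewrite linearNr.
split=> [t|t|t].
- by have [[]] := P t.
- by have [] := dDY t.
rewrite {1}/covariant_derivative; have [_ ->] := dDY t; rewrite DYE /curvature.
rewrite -!torsion_free !(linearBl, linearDr, linearBr, linearDl).
by apply/rowP => j; rewrite !mxE; ring.
Qed.

(** The first equation forces [X = Y' + [u, Y]]. This is also the covariant derivative of [Y] minus
    [nabla Y u], so the Jacobi equation yields its derivative. *)
Lemma jacobi_perturbation Y : jacobi_field br nabla u Y ->
  perturbation Y (fun t => 'D_1 Y t + br (u t) (Y t)).
Proof.
move=> [dY dDY jac] t.
have YE (s : R) : is_derive s 1 Y ('D_1 Y s) by exact: derivableP.
split; first by rewrite addrK; exact: YE.
have -> : (fun s => 'D_1 Y s + br (u s) (Y s)) =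
    fun s => covariant_derivative nabla u Y s - nabla (Y s) (u s).
  apply/funext => s; rewrite /covariant_derivative -torsion_free.
  by apply/rowP => j; rewrite !mxE; ring.
apply: (is_derive_eq (is_deriveB_fun (derivableP (dDY t))
  (is_derive_bilinear nabla (YE t) (u_geod t)))).
have := jac t; rewrite {1}/covariant_derivative /curvature.
move=> /(canRL (addrK _)); rewrite sub0r => /(canRL (addrK _)) ->.
rewrite {}/covariant_derivative.
rewrite -!torsion_free !(linearBl, linearDr, linearBr, linearDl, linearNr).
by apply/rowP => j; rewrite !mxE; ring.
Qed.

End Perturbations.

(** * Explicit Jacobi fields *)

(* With [lam = <z0, z0>], so that J_z0 squares to [- lam], these functions are
   [S = sin (a t) / a], [E = (1 - cos (a t)) / a ^ 2] when [lam = a ^ 2], their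
   hyperbolic analogues when [lam < 0] and [S = t], [E = t ^ 2 / 2] when
   [lam = 0]; thus exp (t J_z0) = (1 - lam E) + S J_z0.  The iterated
   antiderivatives [F], [K], [H] serve to solve all three cases at once. *)
Record trig_kit (R : realType) (lam : R) (S E F K H : R -> R) : Prop :=
  TrigKit {
    kit_dS : forall t : R, is_derive t 1 S (1 - lam * E t);
    kit_dE : forall t : R, is_derive t 1 E (S t);
    kit_dF : forall t : R, is_derive t 1 F (E t);
    kit_dK : forall t : R, is_derive t 1 K (t * E t - F t);
    kit_dH : forall t : R, is_derive t 1 H (E t * E t);
    kit_S0 : S 0 = 0;
    kit_E0 : E 0 = 0;
    kit_F0 : F 0 = 0;
    kit_K0 : K 0 = 0;
    kit_H0 : H 0 = 0;
    kit_S : forall t, S t = t - lam * F t;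
    kit_SS : forall t, S t * S t = 2 * E t - lam * (E t * E t);
    kit_K : forall t,
      (1 - lam * E t) * K t - S t * (t * E t - F t) = - (E t * E t);
    kit_lamK : forall t, lam * K t = 2 * E t - t * S t;
    kit_lamH : forall t, 2 * lam * H t = 3 * F t - S t * E t
  }.

Section ExplicitFields.
Variables (R : realType) (n : nat).
Local Notation V := 'rV[R]_n.
Variables (br : {bilinear V -> V -> V}) (ip : {biscalar V})
  (zz vv : {vspace V}) (nabla : {bilinear V -> V -> V}).
Hypothesis ph : pseudoH_algebra br ip zz vv nabla.
Variables (z0 x0 : V).
Hypotheses (z0_zz : z0 \in zz) (x0_vv : x0 \in vv).
Variables S E F K H : R -> R.
Hypothesis kit : trig_kit (ip z0 z0) S E F K H.

Local Notation J := (Jmap nabla).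
Local Notation cproj := (cproj zz vv).
Local Notation oproj := (oproj zz vv).
Local Notation lam := (ip z0 z0).

(** The symmetrized connection governs both the geodesic equation and its linearization. Brackets of
    components in [vv] cancel by antisymmetry, and only the operators [J] survive. *)
Lemma nabla_sym z w x y : z \in zz -> w \in zz -> x \in vv -> y \in vv ->
  nabla (w + y) (z + x) + nabla (z + x) (w + y) = - J w x - J z y.
Proof.
move=> zz_z zz_w xv yv.
rewrite !(linearDl, linearDr) /=.
rewrite (nabla_center ph zz_z zz_w).
rewrite (nabla_center ph zz_w zz_z).
rewrite (nabla_centerl ph x zz_w).
rewrite (nabla_centerl ph y zz_z).
pose nablaE := nabla_orth ph.
rewrite (nablaE _ _ xv yv) (nablaE _ _ yv xv).
rewrite !(nabla_orth_center nabla) (bracketC ph x y).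
by apply/rowP => j; rewrite !mxE; lra.
Qed.

Lemma nabla_self z x : z \in zz -> x \in vv ->
  nabla (z + x) (z + x) = - J z x.
Proof.
move=> zz_z xv; have /rowP N := nabla_sym zz_z zz_z xv xv.
by apply/rowP => j; have := N j; rewrite !mxE; lra.
Qed.

(** The integrating factor exp(-tJ) makes [W] constant. Applying exp(tJ) to [W] recovers [eta],
    because [kit_SS] amounts to (1 - lam E)^2 + lam S^2 = 1 after multiplication by [lam]. *)
Lemma orth_flow (eta : R -> V) : (forall t, eta t \in vv) ->
  (forall t : R, is_derive t 1 eta (J z0 (eta t))) ->
  forall t, eta t = (1 - lam * E t) *: eta 0 + S t *: J z0 (eta 0).
Proof.
move=> eta_v deta.
have JJ t : J z0 (J z0 (eta t)) = - lam *: eta t.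
  by rewrite (J_sqr ph)//.
pose W t := (1 - lam * E t) *: eta t - S t *: J z0 (eta t).
have dW (t : R) : is_derive t 1 W 0.
  have dC := is_deriveB_fun (is_derive_const 1 t)
    (is_deriveM_fun (is_derive_const lam t) (kit_dE kit t)).
  have dJ := is_derive_bilinearr (J : {bilinear V -> V -> V}) z0 (deta t).
  have dd := is_deriveB_fun (is_derive_scale dC (deta t))
    (is_derive_scale (kit_dS kit t) dJ).
  apply: (is_derive_eq dd).
  by rewrite /= JJ; apply/rowP => j; rewrite !mxE; ring.
have W0 t : W t = eta 0.
  rewrite (is_derive0_cst dW) /W (kit_S0 kit) (kit_E0 kit).
  by rewrite mulr0 subr0 scale1r scale0r subr0.
move=> t; rewrite -(W0 t) /W linearBr !linearZr_LR /= JJ.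
apply/rowP => j; rewrite !mxE.
by have := congr1 (fun c => lam * (c * eta t 0 j)) (kit_SS kit t); lra.
Qed.

Variable u : R -> V.
Hypotheses (u_geod : forall t : R, is_derive t 1 u (- nabla (u t) (u t)))
  (u0 : u 0 = z0 + x0).

(** Since [nabla u u] lies in [vv], the central component of [u] is conserved; the orthogonal one
    then follows the linear flow of [J z0]. *)
Lemma geodesic_velocity t :
  u t = z0 + ((1 - lam * E t) *: x0 + S t *: J z0 x0).
Proof.
have uE s : u s = cproj (u s) + oproj (u s) by rewrite (cproj_oproj ph).
have NE s : nabla (u s) (u s) = - J (cproj (u s)) (oproj (u s)).
  by rewrite [in LHS]uE nabla_self ?cproj_in ?oproj_in.
have cE s : cproj (u s) = z0.
  have -> : z0 = cproj (u 0).
    rewrite u0 linearD /= (cproj_id ph)// (cproj_orth ph)//.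
    by rewrite addr0.
  apply: (is_derive0_cst (f := fun r => cproj (u r))) => r.
  apply: (is_derive_eq (is_derive_lfun cproj (u_geod r))).
  rewrite NE opprK (cproj_orth ph)//.
  by rewrite (J_in ph)// cproj_in.
have o0 : oproj (u 0) = x0.
  rewrite u0 linearD /= (oproj_center ph)// add0r.
  by rewrite (oproj_id ph).
rewrite uE cE -{1 2}o0; congr (_ + _).
apply: (orth_flow (eta := fun r => oproj (u r))) => r.
  exact: oproj_in.
apply: (is_derive_eq (is_derive_lfun oproj (u_geod r))).
rewrite NE cE opprK (oproj_id ph)// (J_in ph)//.
Qed.

(** Uniqueness comes from the triangular shape of the system. The central part of [X] is constant,
    hence zero; its orthogonal part then obeys [orth_flow] and vanishes. With [X = 0] the derivative
    of [Y] is a bracket, so the orthogonal part of [Y] is constantly zero; then [Y] is central, the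
    bracket vanishes and [Y] is constant. *)
Lemma perturbation_eq0 Y X : perturbation br nabla u Y X ->
  Y 0 = 0 -> X 0 = 0 -> forall t, Y t = 0.
Proof.
move=> P Y0 X0.
have xv s : (1 - lam * E s) *: x0 + S s *: J z0 x0 \in vv.
  by rewrite rpredD ?rpredZ ?(J_in ph).
have dX s : - nabla (X s) (u s) - nabla (u s) (X s) =
   J (cproj (X s)) ((1 - lam * E s) *: x0 + S s *: J z0 x0)
   + J z0 (oproj (X s)).
  have := nabla_sym z0_zz (cproj_in zz vv (X s)) (xv s) (oproj_in zz vv (X s)).
  by rewrite (cproj_oproj ph) -geodesic_velocity -opprD => ->; rewrite opprB opprK addrC.
have cX s : cproj (X s) = 0.
  have <- : cproj (X 0) = 0 by rewrite X0 linear0.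
  apply: (is_derive0_cst (f := fun r => cproj (X r))) => r.
  apply: (is_derive_eq (is_derive_lfun cproj (P r).2)).
  rewrite dX (cproj_orth ph)//.
  by rewrite rpredD ?(J_in ph) ?cproj_in.
have oX s : oproj (X s) = 0.
  have dO (r : R) : is_derive r 1 (fun r => oproj (X r)) (J z0 (oproj (X r))).
    apply: (is_derive_eq (is_derive_lfun oproj (P r).2)).
    by rewrite dX cX linear0l add0r (oproj_id ph) ?(J_in ph).
  have -> := orth_flow (fun r => oproj_in zz vv (X r)) dO s.
  by rewrite X0 linear0 linear0r !scaler0 addr0.
have XE s : X s = 0.
  by rewrite -(cproj_oproj ph (X s)) cX oX addr0.
have dY (s : R) : is_derive s 1 Y (- br (u s) (Y s)).
  by apply: (is_derive_eq (P s).1); rewrite XE sub0r.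
have oY s : oproj (Y s) = 0.
  have <- : oproj (Y 0) = 0 by rewrite Y0 linear0.
  apply: (is_derive0_cst (f := fun r => oproj (Y r))) => r.
  apply: (is_derive_eq (is_derive_lfun oproj (dY r))).
  rewrite (oproj_center ph)// rpredN.
  exact: (bracket_in_center ph).
move=> t; rewrite -Y0; apply: is_derive0_cst => s.
apply: (is_derive_eq (dY s)).
rewrite -(cproj_oproj ph (Y s)) oY addr0.
by rewrite (bracket_centerr ph) ?cproj_in ?oppr0.
Qed.

(** * The Jacobi field with a given initial velocity *)

Section Field.
Variable xi : V.
Local Notation z := (cproj xi).
Local Notation y := (oproj xi).
Local Notation s := (ip z z0).
(** The initial derivative of the orthogonal part of the momentum that starts at [xi]. *)
Let q := J z0 y + J z x0.

(** Variation of constants: the source exp(-tJ) [J z x0] contributes [S t *: J z x0], and the source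
    - 2 s S x0 contributes the two terms containing [s]. *)
Definition jmomentum (t : R) : V :=
  z + (1 - lam * E t) *: y + S t *: q - (s * (t * S t)) *: x0
  - (s * (t * E t - F t)) *: J z0 x0.

(** The terms without brackets are antiderivatives of those of [jmomentum]; the terms with brackets
    integrate - [u, Y]. *)
Definition jfield (t : R) : V :=
  t *: z + S t *: y + E t *: q
  - (s * (t * E t - F t)) *: x0 - (s * K t) *: J z0 x0
  - (S t * S t / 2) *: br x0 y - ((S t * E t - F t) / 2) *: br x0 q
  - ((S t * E t + F t) / 2) *: br (J z0 x0) y - (E t * E t / 2) *: br (J z0 x0) q
  - (s * H t) *: br x0 (J z0 x0).

Definition jorth (t : R) : V :=
  S t *: y + E t *: q - (s * (t * E t - F t)) *: x0 - (s * K t) *: J z0 x0.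

Lemma jfield_split t : exists2 c, c \in zz & jfield t = c + jorth t.
Proof.
rewrite /jfield /jorth; move: (J z0 x0) q => a b.
exists (t *: z - (S t * S t / 2) *: br x0 y - ((S t * E t - F t) / 2) *: br x0 b
  - ((S t * E t + F t) / 2) *: br a y - (E t * E t / 2) *: br a b
  - (s * H t) *: br x0 a).
  by rewrite !(rpredB, rpredD, rpredZ) ?cproj_in ?(bracket_in_center ph).
by apply/rowP => j; rewrite !mxE; ring.
Qed.

Lemma oproj_jfield t : oproj (jfield t) = jorth t.
Proof.
have [c cz ->] := jfield_split t.
rewrite linearD /= (oproj_center ph)// add0r (oproj_id ph)//.
by rewrite !(rpredB, rpredD, rpredZ) ?oproj_in ?(J_in ph) ?cproj_in.
Qed.

Lemma bracket_jfield v t : br v (jfield t) =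
  S t *: br v y + E t *: br v q - (s * (t * E t - F t)) *: br v x0
  - (s * K t) *: br v (J z0 x0).
Proof.
have [c cz ->] := jfield_split t.
rewrite linearDr (bracket_centerr ph _ cz) add0r /jorth.
by rewrite 2!linearBr linearDr !linearZr_LR.
Qed.

Lemma jfield_perturbation : perturbation br nabla u jfield jmomentum.
Proof.
have qv : q \in vv by rewrite rpredD ?(J_in ph) ?cproj_in.
move=> t; split.
  have brE : br (u t) (jfield t) =
    ((1 - lam * E t) * S t) *: br x0 y + ((1 - lam * E t) * E t) *: br x0 q
    - (s * ((1 - lam * E t) * K t - S t * (t * E t - F t))) *: br x0 (J z0 x0)
    + (S t * S t) *: br (J z0 x0) y + (S t * E t) *: br (J z0 x0) q.
    rewrite geodesic_velocity (linearDl br) (bracket_centerl ph _ z0_zz) add0r.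
    rewrite linearDl !linearZl_LR /= !bracket_jfield !(ph_lie ph).1.
    rewrite (bracketC ph (J z0 x0) x0).
    by apply/rowP => j; rewrite !mxE; ring.
  rewrite brE (kit_K kit) /jfield /jmomentum; move: (J z0 x0) q => a b.
  have dS := kit_dS kit t; have dE := kit_dE kit t; have dF := kit_dF kit t.
  have dK := kit_dK kit t; have dH := kit_dH kit t.
  have dh := is_derive_const (2^-1) t; have ds := is_derive_const s t.
  have dt := is_derive_arg t.
  have dZ := is_deriveB_fun (is_deriveB_fun (is_deriveD_fun (is_deriveD_fun
    (is_derive_scalel z dt) (is_derive_scalel y dS)) (is_derive_scalel b dE))
    (is_derive_scalel x0 (is_deriveM_fun ds (is_deriveB_fun (is_deriveM_fun dt dE) dF))))
    (is_derive_scalel a (is_deriveM_fun ds dK)).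
  have dZ2 := is_deriveB_fun (is_deriveB_fun (is_deriveB_fun (is_deriveB_fun
     (is_deriveB_fun dZ
    (is_derive_scalel (br x0 y) (is_deriveM_fun (is_deriveM_fun dS dS) dh)))
    (is_derive_scalel (br x0 b)
      (is_deriveM_fun (is_deriveB_fun (is_deriveM_fun dS dE) dF) dh)))
    (is_derive_scalel (br a y)
      (is_deriveM_fun (is_deriveD_fun (is_deriveM_fun dS dE) dF) dh)))
    (is_derive_scalel (br a b) (is_deriveM_fun (is_deriveM_fun dE dE) dh)))
    (is_derive_scalel (br x0 a) (is_deriveM_fun ds dH)).
  apply: (is_derive_eq dZ2).
  apply/rowP => j; rewrite !mxE.
  (* The coefficients of [br x0 b] and [br a y] are antiderivatives only modulo the quadratic
     relation [kit_SS]. *)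
  have r1 := congr1 (fun c => c * br x0 b 0 j) (kit_SS kit t).
  have r2 := congr1 (fun c => c * br a y 0 j) (kit_SS kit t).
  by move: r1 r2; lra.
have Yv : (1 - lam * E t) *: y + S t *: q - (s * (t * S t)) *: x0
  - (s * (t * E t - F t)) *: J z0 x0 \in vv.
  by rewrite !(rpredB, rpredD, rpredZ) ?oproj_in ?(J_in ph) ?cproj_in.
have xv : (1 - lam * E t) *: x0 + S t *: J z0 x0 \in vv.
  by rewrite rpredD ?rpredZ ?(J_in ph).
have mE : jmomentum t = z + ((1 - lam * E t) *: y + S t *: q
    - (s * (t * S t)) *: x0 - (s * (t * E t - F t)) *: J z0 x0).
  by apply/rowP => j; rewrite !mxE; ring.
have := nabla_sym z0_zz (cproj_in zz vv xi) xv Yv.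
rewrite -mE -geodesic_velocity -opprD => ->.
rewrite opprB opprK.
pose Jb : {bilinear V -> V -> V} := J.
rewrite !(linearBr Jb) !(linearDr Jb) !(linearZr_LR Jb) /=.
(* The Clifford relation moves [J z0] to the left of [J z], at the cost of a multiple of [x0]. *)
rewrite /q (linearDr Jb) /= (J_clifford ph (cproj_in zz vv xi) z0_zz x0_vv).
rewrite (J_sqr ph z0_zz x0_vv) (J_sqr ph z0_zz (oproj_in zz vv xi)).
rewrite /jmomentum -/q.
have dS := kit_dS kit t; have dE := kit_dE kit t; have dF := kit_dF kit t.
have ds := is_derive_const s t; have dt := is_derive_arg t.
have d1 := is_derive_const 1 t.
have dm := is_deriveB_fun (is_deriveB_fun (is_deriveD_fun (is_deriveD_fun
    (is_derive_cst z t 1)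
    (is_derive_scalel y (is_deriveB_fun d1 (is_deriveM_fun (is_derive_const lam t) dE))))
    (is_derive_scalel q dS))
    (is_derive_scalel x0 (is_deriveM_fun ds (is_deriveM_fun dt dS))))
    (is_derive_scalel (J z0 x0)
      (is_deriveM_fun ds (is_deriveB_fun (is_deriveM_fun dt dE) dF))).
apply: (is_derive_eq dm); rewrite /q.
apply/rowP => j; rewrite !mxE (kit_S kit).
by ring.
Qed.

Lemma jfield0 : jfield 0 = 0.
Proof.
rewrite /jfield (kit_S0 kit) (kit_E0 kit) (kit_F0 kit) (kit_K0 kit) (kit_H0 kit).
by apply/rowP => j; rewrite !mxE; ring.
Qed.

Lemma jmomentum0 : jmomentum 0 = xi.
Proof.
rewrite /jmomentum (kit_S0 kit) (kit_E0 kit) (kit_F0 kit).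
rewrite -[RHS](cproj_oproj ph).
by apply/rowP => j; rewrite !mxE; ring.
Qed.

Lemma jfield_jacobi : jacobi_field br nabla u jfield.
Proof. exact: (perturbation_jacobi (ph_LC ph).1 u_geod jfield_perturbation). Qed.

End Field.

(** As [Y 0 = 0], the initial value of [X] is the derivative of [Y] at 0. The difference with the
    explicit field has zero initial data, so [perturbation_eq0] applies. *)
Lemma jacobi_jfield Y : jacobi_field br nabla u Y -> Y 0 = 0 ->
  Y = jfield ('D_1 Y 0).
Proof.
move=> jY Y0; apply/funext => t; apply/eqP; rewrite -subr_eq0; apply/eqP.
have pY := jacobi_perturbation (ph_LC ph).1 u_geod jY.
apply: (perturbation_eq0 (perturbationB pY (jfield_perturbation _)) _ _ t).
  by rewrite Y0 jfield0 subrr.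
by rewrite jmomentum0 Y0 linear0r addr0 subrr.
Qed.

Lemma jfield_is_linear t : linear (jfield ^~ t).
Proof.
move=> a v w; rewrite /jfield !(linearP cproj) !(linearP oproj) /=.
move: (cproj v) (cproj w) (oproj v) (oproj w) => zv zw yv yw.
pose Jb : {bilinear V -> V -> V} := J.
rewrite (linearPr Jb) (linearPl Jb) (linearPl ip) /=.
have -> : a *: J z0 yv + J z0 yw + (a *: J zv x0 + J zw x0) =
   a *: (J z0 yv + J zv x0) + (J z0 yw + J zw x0).
  by apply/rowP => j; rewrite !mxE; ring.
rewrite !(linearPr br) /=.
by apply/rowP => j; rewrite !mxE; ring.
Qed.

End ExplicitFields.

(** * Jacobi fields vanishing at two points *)

Lemma has_dimension_image (R : realType) (V : vectType R) (W : lmodType R)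
    (P : W -> Prop) (f : V -> W) (U : {vspace V}) : linear f -> injective f ->
  (forall y, P y <-> exists2 x, x \in U & y = f x) -> has_dimension P (\dim U).
Proof.
move=> f_lin f_inj PE.
pose fL : {linear V -> W} := HB.pack f (GRing.isLinear.Build _ _ _ _ f f_lin).
have fsum (c : 'rV[R]_(\dim U)) : \sum_i c 0 i *: f (vbasis U)`_i =
    f (\sum_i c 0 i *: (vbasis U)`_i).
  by rewrite -[RHS]/(fL _) linear_sum; apply: eq_bigr => i _; rewrite linearZ.
exists (fun i => f (vbasis U)`_i); split=> [c|y /PE[x xU ->]].
  apply/PE; eexists; last exact: fsum.
  by apply: rpred_sum => i _; rewrite rpredZ// vbasis_mem// mem_nth// size_tuple.
exists (\row_i coord (vbasis U) i x); split=> [|c].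
  rewrite fsum; congr f; rewrite {1}(coord_vbasis xU).
  by apply: eq_bigr => i _; rewrite mxE.
rewrite fsum => /f_inj ->; apply/rowP => i; rewrite mxE.
by rewrite coord_sum_free// (basis_free (vbasisP U)).
Qed.

Section VanishingFields.
Variables (R : realType) (n : nat).
Local Notation V := 'rV[R]_n.
Variables (br : {bilinear V -> V -> V}) (ip : {biscalar V})
  (zz vv : {vspace V}) (nabla : {bilinear V -> V -> V}).
Hypothesis ph : pseudoH_algebra br ip zz vv nabla.
Variables (z0 x0 : V).
Hypotheses (z0_zz : z0 \in zz) (x0_vv : x0 \in vv).
Variables S E F K H : R -> R.
Hypothesis kit : trig_kit (ip z0 z0) S E F K H.
Variable u : R -> V.
Hypotheses (u_geod : forall t : R, is_derive t 1 u (- nabla (u t) (u t)))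
  (u0 : u 0 = z0 + x0).

Local Notation J := (Jmap nabla).
Local Notation cproj := (cproj zz vv).
Local Notation oproj := (oproj zz vv).
Local Notation lam := (ip z0 z0).
Local Notation p := (ip x0 x0).
Local Notation jfield := (jfield br ip zz vv nabla z0 x0 S E F K H).
Local Notation jmomentum := (jmomentum ip zz vv nabla z0 x0 S E F).

(** The derivative of [jfield xi] at 0 is [xi], so the parametrization by initial velocities is
    injective. *)
Lemma jfield_eq0 xi : jfield xi = 0 -> xi = 0.
Proof.
move=> j0; rewrite -(jmomentum0 ph x0 kit xi).
have [[_ dj] _] := jfield_perturbation ph z0_zz x0_vv kit u_geod u0 xi 0.
move: dj; rewrite (jfield0 _ _ _ _ _ kit) linear0r subr0 => <-.
by rewrite j0; exact: derive_cst.
Qed.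

Variable T : R.
Hypothesis T0 : T != 0.

Definition jeval : {linear V -> V} := HB.pack (jfield ^~ T)
  (GRing.isLinear.Build _ _ _ _ (jfield ^~ T)
    (jfield_is_linear br ip zz vv nabla z0 x0 S E F K H T)).

(** The initial velocities of the Jacobi fields that vanish at 0 and [T]; conjugacy and multiplicity
    are read off its dimension. *)
Definition vanishing : {vspace V} := lker (linfun jeval).

Lemma vanishingE xi : (xi \in vanishing) = (jfield xi T == 0).
Proof. by rewrite memv_ker lfunE. Qed.

Lemma vanishing_jacobiP Y : vanishing_jacobi_field br nabla u T Y <->
  exists2 xi, xi \in vanishing & Y = jfield xi.
Proof.
split=> [[jY Y0 YT]|[xi xiK ->]]; last first.
  split; first exact: (jfield_jacobi ph).
    exact: (jfield0 _ _ _ _ _ kit).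
  by apply/eqP; rewrite -vanishingE.
have YE := jacobi_jfield ph z0_zz x0_vv kit u_geod u0 jY Y0.
by exists ('D_1 Y 0) => //; rewrite vanishingE -YE YT.
Qed.

Lemma mult_vanishing : mult_cp br nabla u T (\dim vanishing).
Proof.
apply: (has_dimension_image (f := jfield)) => [||Y].
- by move=> a v w; apply/funext => t; exact: jfield_is_linear.
- move=> v w vw; apply/eqP; rewrite -subr_eq0; apply/eqP/jfield_eq0.
  apply/funext => t; rewrite -[v - w]addrC -scaleN1r.
  by rewrite jfield_is_linear vw scaleN1r addNr.
exact: vanishing_jacobiP.
Qed.

Lemma conjugate_vanishing :
  conjugate_point br nabla u T <-> \dim vanishing != 0%N.
Proof.
rewrite dimv_eq0; split=> [[Y [/vanishing_jacobiP[xi xiK YE] [t Yt]]]|K0].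
  apply: contra_neq Yt => K0; move: xiK; rewrite K0 memv0 YE => /eqP ->.
  have := jfield_is_linear br ip zz vv nabla z0 x0 S E F K H t (-1) 0 0.
  by rewrite !scaleN1r oppr0 addr0 addNr.
exists (jfield (vpick vanishing)); split.
  by apply/vanishing_jacobiP; exists (vpick vanishing); rewrite ?memv_pick.
apply: contrapT => /forallNP j0.
have : vpick vanishing != 0 by rewrite vpick0.
move=> /eqP; apply; apply: jfield_eq0; apply/funext => t.
by have /negP := j0 t; rewrite negbK => /eqP.
Qed.

(** * Orthogonal and central parts of the vanishing condition *)

Section Pairing.
Variable xi : V.
Local Notation z := (cproj xi).
Local Notation y := (oproj xi).
Local Notation s := (ip z z0).

(** Pairing with a central [w] turns [x0, v] into <J_w x0, v>. For [J_z0 x0, v] the Clifford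
    relation and skewness move [J z0] onto [v], which leaves a multiple of <w, z0>. *)
Lemma ip_jfield w : w \in zz -> ip w (jfield xi T) =
  (T - (S T * E T - F T) / 2 * p) * ip w z
  - (S T * S T - lam * (E T * E T)) / 2 * ip (J w x0) y
  - S T * E T * ip (J w x0) (J z0 y)
  - E T * E T / 2 * ip (J w x0) (J z0 (J z x0))
  + ((S T * E T + F T) * ip x0 y + E T * E T * ip x0 (J z0 y) - s * H T * p)
    * ip w z0.
Proof.
move=> wz.
have bx v : ip w (br x0 v) = ip (J w x0) v by rewrite (ip_J ph).
have ba v : ip w (br (J z0 x0) v) =
    ip (J w x0) (J z0 v) - 2 * ip w z0 * ip x0 v.
  rewrite -(ip_J ph)// (J_clifford ph wz z0_zz x0_vv).
  by rewrite linearBl linearNl linearZl_LR /= (J_skew ph _ _ z0_zz) opprK.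
have wv v : v \in vv -> ip w v = 0 by exact: (ip_center_orth ph).
have zc : z \in zz by rewrite cproj_in.
have yv : y \in vv by rewrite oproj_in.
rewrite /jfield !(linearBr ip) !(linearDr ip) !(linearZr_LR ip) /=.
have wJ v v' : v \in zz -> ip w (J v v') = 0 by move=> vz; rewrite wv ?(J_in ph).
rewrite !(linearDr br) /= !(linearDr ip) /= !bx !ba.
rewrite (wv y)// (wv x0)// !(wJ z0)// (wJ z)//.
rewrite (J_sqr ph z0_zz yv).
rewrite (linearZr_LR ip) /= (ip_J_same ph wz zc x0_vv) (ip_J_same ph wz z0_zz x0_vv).
rewrite (ip_x_Jx ph x0 zc).
by lra.
Qed.


Lemma vanishing_split : xi \in vanishing <->
  jorth ip zz vv nabla z0 x0 S E F K xi T = 0 /\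
  forall w, w \in zz -> ip w (jfield xi T) = 0.
Proof.
rewrite vanishingE -(oproj_jfield ph z0_zz x0_vv S E F K H xi T).
split=> [/eqP -> | [jo c0]]; first by split=> [|w _]; rewrite ?linear0 ?linear0r.
rewrite -(cproj_oproj ph (jfield xi T)) jo addr0.
apply/eqP/(center_eq0 ph); first exact: cproj_in.
move=> w wz; rewrite -(c0 w wz) -[in RHS](cproj_oproj ph (jfield xi T)) jo.
by rewrite addr0.
Qed.

End Pairing.

(** * Times that are not periods of exp(tJ) *)

Section Regular.
Hypothesis E_neq0 : E T != 0.

Let K1 := T * E T - F T.
Let M := S T * K1 + lam * E T * K T.
Let N := S T * K T - E T * K1.
Let Q := (S T * E T + F T) / 2.

(* The coefficient of [- p <zeta, z0> z0] in the central part of [jfield xi T]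
   when [zeta = cproj xi] and [oproj xi = oinit zeta]. *)
Definition kappa : R := (S T * K T + E T * K1) / 2 + Q * E T - Q * M / E T
  - S T * E T ^+ 2 / 2 + lam * N * E T / 2 + H T.

(* The solution [y] of [jorth xi T = 0], obtained by applying [S - E J_z0] to that
   equation: (S + E J_z0) (S - E J_z0) = 2 E. *)
Definition oinit z : V :=
  - (S T / 2) *: J z x0 + (E T / 2) *: J z0 (J z x0)
  + (ip z z0 / (2 * E T)) *: (M *: x0 + N *: J z0 x0).

Lemma J_oinit z : z \in zz -> J z0 (oinit z) =
  - (S T / 2) *: J z0 (J z x0) - (lam * E T / 2) *: J z x0
  + (ip z z0 / (2 * E T)) *: (M *: J z0 x0 - (lam * N) *: x0).
Proof.
move=> zc; rewrite /oinit; pose Jb : {bilinear V -> V -> V} := J.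
rewrite !(linearDr Jb) !(linearZr_LR Jb) /= !(linearDr Jb) !(linearZr_LR Jb) /=.
rewrite (J_sqr ph z0_zz x0_vv) (J_sqr ph z0_zz) ?(J_in ph)//.
by apply/rowP => j; rewrite !mxE; ring.
Qed.

Lemma jorth_eq0 xi : jorth ip zz vv nabla z0 x0 S E F K xi T = 0 <->
  oproj xi = oinit (cproj xi).
Proof.
have zc := cproj_in zz vv xi.
have SS := kit_SS kit T.
split=> [j0|yE]; last first.
  rewrite /jorth yE (J_oinit zc) /oinit /M /N -/K1.
  apply/rowP => j; rewrite !mxE.
  move: (J _ _ 0 j) (J z0 (J _ _) 0 j) (J z0 x0 0 j) (x0 0 j) => wj Jwj aj xj.
  (* Every coordinate carries the factor S^2 + lam E^2 - 2 E, which [kit_SS] annihilates. *)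
  have -> : S T * (- (S T / 2) * wj + E T / 2 * Jwj
     + ip (cproj xi) z0 / (2 * E T) * ((S T * K1 + lam * E T * K T) * xj
       + (S T * K T - E T * K1) * aj))
   + E T * (- (S T / 2) * Jwj - lam * E T / 2 * wj
     + ip (cproj xi) z0 / (2 * E T) * ((S T * K1 + lam * E T * K T) * aj
       - (lam * (S T * K T - E T * K1)) * xj) + wj)
   - ip (cproj xi) z0 * K1 * xj - ip (cproj xi) z0 * K T * aj =
   (S T * S T + lam * (E T * E T) - 2 * E T) *
   (ip (cproj xi) z0 * (K1 * xj + K T * aj) / (2 * E T) - wj / 2).
    by field.
  by rewrite SS; ring.
have Jj0 : J z0 (jorth ip zz vv nabla z0 x0 S E F K xi T) = 0.
  by rewrite j0 linear0r.
move: Jj0 j0; rewrite /jorth -/K1; pose Jb : {bilinear V -> V -> V} := J.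
rewrite !(linearBr Jb) !(linearDr Jb) !(linearZr_LR Jb) /=.
rewrite !(linearDr Jb) /= (J_sqr ph z0_zz x0_vv) (J_sqr ph z0_zz) ?oproj_in//.
move=> /rowP e1 /rowP e2; apply/rowP => j.
have := e1 j; have := e2 j; rewrite !mxE /M /N.
move: (J _ _ 0 j) (J z0 (J _ _) 0 j) (J z0 (oproj xi) 0 j) (oproj xi 0 j).
move: (J z0 x0 0 j) (x0 0 j) (ip (cproj xi) z0) => aj xj s wj Jwj Jyj yj h2 h1.
have E2 : 2 * E T != 0 by rewrite mulf_neq0 ?pnatr_eq0.
apply: (mulfI E2).
have -> : 2 * E T * yj = - (S T * E T * wj) + E T * E T * Jwj +
  s * ((S T * K1 + lam * E T * K T) * xj + (S T * K T - E T * K1) * aj).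
  have := congr1 (fun c => S T * c) h2; have := congr1 (fun c => E T * c) h1.
  by have := congr1 (fun c => c * yj) SS => /=; lra.
by field.
Qed.

Lemma ip_jfield_oinit xi w : oproj xi = oinit (cproj xi) -> w \in zz ->
  ip w (jfield xi T) =
  (T + p * F T / 2) * ip w (cproj xi)
  - p * kappa * ip (cproj xi) z0 * ip w z0.
Proof.
move=> yE wz; have zc := cproj_in zz vv xi.
have wx : ip (J w x0) x0 = 0 by rewrite (ipC ph); exact: (ip_x_Jx ph).
rewrite (ip_jfield _ wz) yE (J_oinit zc) /oinit.
move: (cproj xi) zc => z zc.
have xJ : ip x0 (J z0 (J z x0)) = - (ip z z0 * p).
  have := J_skew ph x0 (J z x0) z0_zz; rewrite (ip_J_same ph z0_zz zc x0_vv).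
  by rewrite (ipC ph z0) => ->; rewrite opprK.
rewrite !(linearDr ip) /= !(linearZr_LR ip) /= !(linearDr ip) /=.
rewrite !(linearNr ip) /= !(linearZr_LR ip) /=.
rewrite (ip_J_same ph wz zc x0_vv) (ip_J_same ph wz z0_zz x0_vv) wx xJ.
rewrite (ip_x_Jx ph x0 zc) (ip_x_Jx ph x0 z0_zz) /kappa /M /N /Q.
have := kit_SS kit T.
move: (ip (J w x0) _) (ip w z) (ip z z0) (ip w z0) p lam => Jc wz' s sw P L SS.
apply/eqP; rewrite -subr_eq0; apply/eqP.
(* The discrepancy is again a multiple of the relation [kit_SS]. In particular [Jc], the pairing of
   [J w x0] with [J z0 (J z x0)], drops out. *)
transitivity ((S T * S T - (2 * E T - L * (E T * E T))) * (E T / 2 * Jc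
  - (- (S T / 2) * (wz' * P) + E T / 2 * Jc
     + s / (2 * E T) * ((S T * K T - E T * K1) * (sw * P))) / 2
  - K1 / 2 * P * s * sw)).
  by field.
by rewrite SS subrr mul0r.
Qed.


(** The operator taking zeta to a zeta - b <zeta, z0> z0 has eigenvalue [a] on the orthogonal of
    [z0] in the center and [a - b * lam] along [z0]. *)
Let a := T + p * F T / 2.
Let b := p * kappa.

Lemma oinit_in z : z \in zz -> oinit z \in vv.
Proof. by move=> zc; rewrite !(rpredD, rpredZ) ?(J_in ph). Qed.

Lemma vanishing_regular xi : xi \in vanishing <->
  oproj xi = oinit (cproj xi) /\
  a *: cproj xi = (b * ip (cproj xi) z0) *: z0.
Proof.
rewrite vanishing_split jorth_eq0.
have zc := cproj_in zz vv xi.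
split=> -[yE c0]; split=> //; last first.
  move=> w wz; rewrite ip_jfield_oinit//.
  by have := congr1 (ip w) c0; rewrite !(linearZr_LR ip) /= /a /b; lra.
apply/eqP; rewrite -subr_eq0; apply/eqP/(center_eq0 ph).
  by rewrite rpredB ?rpredZ.
move=> w wz; rewrite (linearBr ip) /= !(linearZr_LR ip) /=.
by rewrite -(c0 w wz) ip_jfield_oinit.
Qed.

(** The projection [cproj] is injective on [vanishing], since [oinit] recovers the orthogonal
    component from the central one and sends 0 to 0. *)
Lemma dim_vanishing_regular (U : {vspace V}) :
  (forall z, z \in U <-> z \in zz /\ a *: z = (b * ip z z0) *: z0) ->
  \dim vanishing = \dim U.
Proof.
move=> UE.
rewrite -(limg_dim_eq (f := cproj) (U := vanishing)).
  congr (\dim _); apply/vspaceP => z; apply/idP/idP => [/memv_imgP|/UE[zc aE]].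
    by move=> [xi /vanishing_regular[_ aE] ->]; apply/UE; rewrite cproj_in.
  have hv := oinit_in zc.
  have cE : cproj (z + oinit z) = z.
    by rewrite linearD /= (cproj_id ph zc) (cproj_orth ph hv) addr0.
  have oE : oproj (z + oinit z) = oinit z.
    by rewrite linearD /= (oproj_center ph zc) (oproj_id ph hv) add0r.
  apply/memv_imgP; exists (z + oinit z) => //.
  by apply/vanishing_regular; rewrite cE oE.
apply/eqP; rewrite -subv0; apply/subvP => xi /memv_capP[/vanishing_regular[yE _]].
rewrite memv_ker memv0 => /eqP c0.
rewrite -(cproj_oproj ph xi) yE c0 /oinit !(linear0l, linear0r).
by rewrite !(scaler0, mul0r, scale0r, addr0).
Qed.

Hypothesis z0_neq0 : z0 != 0.

Lemma center_witness : exists2 w, w \in zz & ip w z0 != 0.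
Proof.
apply: contrapT => /forallPNP w0; case/eqP: z0_neq0.
by apply: (center_eq0 ph z0_zz) => w /w0/negP; rewrite negbK => /eqP.
Qed.

Lemma dim_regular0 : a != 0 -> a != b * lam -> \dim vanishing = 0%N.
Proof.
move=> a0 ab; rewrite (@dim_vanishing_regular 0%VS) ?dimv0// => z.
rewrite memv0; split=> [/eqP ->|[zc aE]].
  by rewrite mem0v linear0l mulr0 scale0r scaler0.
have : (a - b * lam) * ip z z0 = 0.
  have := congr1 (ip^~ z0) aE; rewrite !(linearZl_LR ip) /=; lra.
move/eqP; rewrite mulf_eq0 subr_eq0 (negPf ab) /= => /eqP s0.
by move/eqP: aE; rewrite s0 mulr0 scale0r scaler_eq0 (negPf a0).
Qed.

Lemma dim_regular1 : a != 0 -> a = b * lam -> \dim vanishing = 1%N.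
Proof.
move=> a0 ab; rewrite (@dim_vanishing_regular <[z0]>%VS) ?dim_vline ?z0_neq0//.
move=> z; split=> [/vlineP[k ->]|[zc aE]].
  by rewrite rpredZ// (linearZl_LR ip) /= scalerA ab; split=> //; congr (_ *: _); ring.
apply/vlineP; exists (a^-1 * (b * ip z z0)).
by rewrite -scalerA -aE scalerA mulVf// scale1r.
Qed.

(** Only <zeta, z0> = 0 remains. This has codimension one even for a null [z0], because the
    nondegenerate center contains a vector not orthogonal to [z0]. *)
Lemma dim_regular_pred : a = 0 -> b != 0 -> \dim vanishing = (\dim zz - 1)%N.
Proof.
move=> a0 b0.
have [k x y|U [UE dimU]] := @form_kernel _ _ (ip^~ z0) zz.
  by rewrite (linearPl ip).
have [w wz w0] := center_witness.
rewrite -(dimU w wz w0); apply: dim_vanishing_regular => z.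
rewrite UE a0 scale0r; split=> -[zc]; first by move=> ->; rewrite mulr0 scale0r.
move/esym/eqP; rewrite scaler_eq0 (negPf z0_neq0) orbF mulf_eq0 (negPf b0) /=.
by move/eqP.
Qed.

Lemma dim_regular_full : a = 0 -> b = 0 -> \dim vanishing = \dim zz.
Proof.
move=> a0 b0; apply: dim_vanishing_regular => z.
by rewrite a0 b0 mul0r !scale0r; split=> // -[].
Qed.

Lemma regular_conjugate (P1 P2 : Prop) : lam != 0 ->
  (P1 <-> a = b * lam) -> (P2 <-> (2 <= \dim zz)%N /\ a = 0) ->
  let mult := mult_cp br nabla u T in
  [/\ conjugate_point br nabla u T <-> P1 \/ P2,
      P1 /\ ~ P2 -> mult 1%N,
      P2 /\ ~ P1 -> mult (\dim zz - 1)%N &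
      P1 /\ P2 -> mult (\dim zz)].
Proof.
move=> lam0 /propext -> /propext -> /=; rewrite (propext conjugate_vanishing).
have m0 : (0 < \dim zz)%N.
  rewrite lt0n dimv_eq0; apply: contraNneq z0_neq0 => zz0.
  by rewrite -memv0 -zz0.
have := mult_vanishing.
have [a0|a0] := eqVneq a 0; have [r0|r0] := eqVneq a (b * lam).
- have b0 : b = 0.
    by move/esym/eqP: r0; rewrite a0 mulf_eq0 (negPf lam0) orbF => /eqP.
  (* If [\dim zz] is 1, then [P2] fails although [a = 0], and the full dimension is the multiplicity
     1 claimed under [P1]. *)
  rewrite dim_regular_full//; move: m0; case: (\dim zz) => [//|[|m]] _ Vm.
  + by split=> //; [split=> // _; left | case=> -[]].
  by split=> //; [split=> // _; left | case=> _ [] | case=> _ []].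
- have b0 : b != 0 by apply: contraNneq r0 => b0; rewrite a0 b0 mul0r.
  (* Here [\dim zz - 1] is nonzero exactly under the clause [2 <= \dim zz] of [P2]. *)
  rewrite dim_regular_pred// subn_eq0 -ltnNge => Vm.
  have r1 : ~ a = b * lam by apply/eqP.
  split; first by split=> [?|[/r1//|[]//]]; right.
  - by case=> /r1.
  - by [].
  - by case=> /r1.
- have a1 : ~ ((2 <= \dim zz)%N /\ a = 0) by case=> _; apply/eqP.
  rewrite dim_regular1// => Vm.
  by split=> //; [split=> // _; left | case=> /a1 | case=> _ /a1].
have r1 : ~ a = b * lam by apply/eqP.
have a1 : ~ ((2 <= \dim zz)%N /\ a = 0) by case=> _; apply/eqP.
rewrite dim_regular0// => Vm.
by split; [split=> // -[/r1|/a1] | case=> /r1 | case=> /a1 | case=> /r1].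
Qed.

End Regular.

(** * Periods of exp(tJ) *)

Section Singular.
Hypotheses (E_eq0 : E T = 0) (z0_neq0 : z0 != 0) (x0_neq0 : x0 != 0).

Let a := T + p * F T / 2.

(** At a period [S], [E] and [K] vanish and [T = lam * F T], so [lam] and [F T] are nonzero. The
    orthogonal part reduces to a multiple of <zeta, z0> x0, and then the central part to a zeta + F
    <x0, y> z0. *)
Lemma vanishing_singular xi : xi \in vanishing <->
  [/\ ip xi z0 = 0, ip xi x0 = 0 & a *: cproj xi = 0].
Proof.
have zc := cproj_in zz vv xi; have yv := oproj_in zz vv xi.
have S0 : S T = 0.
  have := kit_SS kit T; rewrite E_eq0 !mulr0 subrr => /eqP.
  by rewrite mulf_eq0 orbb => /eqP.
have TF : T = lam * F T by have := kit_S kit T; rewrite S0; lra.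
have KT : K T = 0 by have := kit_K kit T; rewrite E_eq0 S0; lra.
have F0 : F T != 0 by apply: contraNneq T0 => F0; rewrite TF F0 mulr0.
have lam0 : lam != 0 by apply: contraNneq T0 => lam0; rewrite TF lam0 mul0r.
have -> : ip xi z0 = ip (cproj xi) z0.
  by rewrite -{1}(cproj_oproj ph xi) (linearDl ip) (ip_orth_center ph z0_zz yv) addr0.
have -> : ip xi x0 = ip x0 (oproj xi).
  rewrite -{1}(cproj_oproj ph xi) (linearDl ip) (ip_center_orth ph zc x0_vv) add0r.
  exact: (ipC ph).
have jE : jorth ip zz vv nabla z0 x0 S E F K xi T =
    (ip (cproj xi) z0 * F T) *: x0.
  by rewrite /jorth S0 E_eq0 KT; apply/rowP => j; rewrite !mxE; ring.
have ipE w : w \in zz -> ip (cproj xi) z0 = 0 -> ip w (jfield xi T) =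
   ip w (a *: cproj xi + (F T * ip x0 (oproj xi)) *: z0).
  move=> wz s0; rewrite ip_jfield// S0 E_eq0 s0 (linearDr ip) !(linearZr_LR ip) /=.
  by rewrite /a; lra.
rewrite vanishing_split jE; split=> [[/eqP]|[s0 y0 az]].
  rewrite scaler_eq0 (negPf x0_neq0) orbF mulf_eq0 (negPf F0) orbF => /eqP s0 c0.
  have az : a *: cproj xi + (F T * ip x0 (oproj xi)) *: z0 = 0.
    apply: (center_eq0 ph); first by rewrite rpredD ?rpredZ.
    by move=> w wz; rewrite -ipE// c0.
  (* Pairing with [z0], to which the central component is already orthogonal, isolates
     [ip x0 (oproj xi)]. *)
  have /eqP := congr1 (ip^~ z0) az.
  rewrite (linearDl ip) !(linearZl_LR ip) /= s0 mulr0 add0r linear0l.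
  rewrite !mulf_eq0 (negPf lam0) (negPf F0) orbF /= => /eqP y0.
  by split=> //; move: az; rewrite y0 mulr0 scale0r addr0.
rewrite s0 mul0r scale0r; split=> // w wz.
by rewrite ipE// az y0 mulr0 scale0r addr0 linear0r.
Qed.

Lemma orth_witness : exists2 y, y \in vv & ip y x0 != 0.
Proof.
apply: contrapT => /forallPNP y0; case/eqP: x0_neq0.
apply: (orth_eq0 ph x0_vv) => y /y0/negP; rewrite negbK (ipC ph) => /eqP //.
Qed.

Lemma dim_singular_orth : a != 0 -> \dim vanishing = (\dim vv - 1)%N.
Proof.
move=> a0; have [k x y|U [UE dimU]] := @form_kernel _ _ (ip^~ x0) vv.
  by rewrite (linearPl ip).
have [y yv y0] := orth_witness.
rewrite -(dimU y yv y0); congr (\dim _); apply/vspaceP => xi.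
apply/idP/idP => [/vanishing_singular[_ y0']|/UE[xv y0']].
  move/eqP; rewrite scaler_eq0 (negPf a0) /= => /eqP c0; apply/UE; split=> //.
  by rewrite -(cproj_oproj ph xi) c0 add0r oproj_in.
apply/vanishing_singular; split=> //; first exact: (ip_orth_center ph).
by rewrite (cproj_orth ph) ?scaler0.
Qed.

Lemma dim_singular_full : a = 0 -> \dim vanishing = (n - 2)%N.
Proof.
move=> a0; have [k x y|U [UE dimU]] := @form_kernel _ _ (ip^~ z0) fullv.
  by rewrite (linearPl ip).
have [k x y|W [WE dimW]] := @form_kernel _ _ (ip^~ x0) U.
  by rewrite (linearPl ip).
have [w wz w0] := center_witness z0_neq0; have [y yv y0] := orth_witness.
(* The two conditions are independent: this [y] satisfies the first and violates the second. *)
have yU : y \in U by apply/UE; rewrite memvf (ip_orth_center ph).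
have -> : vanishing = W.
  apply/vspaceP => xi; apply/idP/idP => [/vanishing_singular[s0 y0' _]|].
    by apply/WE; split=> //; apply/UE; rewrite memvf.
  move=> /WE[/UE[_ s0] y0']; apply/vanishing_singular.
  by rewrite a0 scale0r.
rewrite (dimW y yU y0) (dimU w (memvf _) w0) dimvf /dim /= mul1n.
by rewrite -subnDA.
Qed.

End Singular.
End VanishingFields.

(** * Trigonometric and hyperbolic solutions *)

Section TrigKits.
Variable R : realType.
Implicit Types x t a b lam : R.

Lemma is_derive_rescale (f : R -> R) a t d : is_derive (a * t) 1 f d ->
  is_derive t 1 (fun x => f (a * x)) (a * d).
Proof.
move=> fd; have dm : is_derive t 1 (fun x : R => a * x) a.
  apply: (is_derive_eq (is_deriveM_fun (is_derive_const a t) (is_derive_arg t))).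
  by rewrite mul0r mulr1 add0r.
by apply: (is_derive_eq (is_derive1_comp fd dm)); rewrite mulrC.
Qed.

Lemma is_derive_expRN x : is_derive x 1 (fun y : R => expR (- y)) (- expR (- x)).
Proof.
have -> : (fun y : R => expR (- y)) = fun y => expR (-1 * y).
  by apply/funext => y; rewrite mulN1r.
by apply: (is_derive_eq (is_derive_rescale (is_derive_expR (-1 * x)))); rewrite !mulN1r.
Qed.

Lemma sinh_derive x : is_derive x 1 (@sinh R) (cosh x).
Proof.
apply: (is_derive_eq (is_deriveM_fun
  (is_deriveB_fun (is_derive_expR x) (is_derive_expRN x))
  (is_derive_const (2^-1) x))).
by rewrite /cosh; ring.
Qed.

Lemma cosh_derive x : is_derive x 1 (@cosh R) (sinh x).
Proof.
apply: (is_derive_eq (is_deriveM_fun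
  (is_deriveD_fun (is_derive_expR x) (is_derive_expRN x))
  (is_derive_const (2^-1) x))).
by rewrite /sinh; ring.
Qed.

Lemma expR_mulN x : expR x * expR (- x) = 1.
Proof. by rewrite -expRD subrr expR0. Qed.

Lemma cosh2_sinh2 x : cosh x ^+ 2 - sinh x ^+ 2 = 1.
Proof.
by rewrite -(expR_mulN x) /cosh /sinh; field.
Qed.

Lemma sinh_double x : sinh (2 * x) = 2 * sinh x * cosh x.
Proof.
by rewrite /sinh /cosh !mulr2n !mulrDl !mul1r opprD !expRD; field.
Qed.

Lemma cosh_double x : cosh (2 * x) = 1 + 2 * sinh x ^+ 2.
Proof.
rewrite -[X in X + _](expR_mulN x) /sinh /cosh (_ : 2 * x = x + x); last by ring.
by rewrite opprD !expRD; field.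
Qed.

Lemma sinh_eq0 x : (sinh x == 0) = (x == 0).
Proof.
rewrite /sinh mulf_eq0 invr_eq0 pnatr_eq0 orbF subr_eq0.
rewrite (inj_eq (@expR_inj R)); apply/eqP/eqP; lra.
Qed.

Lemma sin_double x : sin (2 * x) = 2 * sin x * cos x.
Proof. by rewrite mulr_natl sin_mulr2n; ring. Qed.

Lemma cos_double x : cos (2 * x) = 1 - 2 * sin x ^+ 2.
Proof. by rewrite mulr_natl cos_mulr2n cos2sin2; ring. Qed.

Lemma sin_natpi (k : nat) : sin (k%:R * pi) = 0 :> R.
Proof.
by rewrite mulr_natl -[_ *+ _]add0r (alternatingn (@sinDpi R)) sin0 mulr0.
Qed.

(** For [0 <= x], let [k] be the integer part of x / pi. If x - k pi were positive it would lie in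
    (0, pi), where the sine is positive, yet its sine equals that of [x] up to sign. *)
Lemma sin_eq0P x : sin x = 0 <-> exists k : int, x = k%:~R * pi.
Proof.
split=> [|[[k|k] ->]]; first last.
- by rewrite NegzE mulrNz mulNr sinN -pmulrn sin_natpi oppr0.
- by rewrite -pmulrn sin_natpi.
wlog x0 : x / 0 <= x => [th sx|sx].
  have [x0|x0] := leP 0 x; first exact: th.
  have [||k kE] := th (- x); rewrite ?oppr_ge0 ?ltW ?sinN ?sx ?oppr0//.
  by exists (- k); rewrite mulrNz mulNr -kE opprK.
have pi0 := pi_gt0 R.
have := truncn_itv (divr_ge0 x0 (ltW pi0)).
set k := Num.truncn _ => /andP[].
rewrite ler_pdivlMr// ltr_pdivrMr// -natr1 mulrDl mul1r => kx xk.
exists k; rewrite -pmulrn; apply/eqP; rewrite eq_le kx andbT leNgt.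
apply/negP => xgt.
have : 0 < sin (x - k%:R * pi).
  by apply: sin_gt0_pi; rewrite subr_gt0 xgt ltrBlDl.
have := alternatingn (@sinDpi R) k (x - k%:R * pi).
rewrite -[pi *+ k]mulr_natl subrK sx => /esym/eqP.
by rewrite mulf_eq0 signr_eq0 /= => /eqP ->; rewrite ltxx.
Qed.

Lemma trig_kit_neq0 lam (S E : R -> R) : lam != 0 ->
  (forall t : R, is_derive t 1 S (1 - lam * E t)) ->
  (forall t : R, is_derive t 1 E (S t)) -> S 0 = 0 -> E 0 = 0 ->
  (forall t, S t * S t = 2 * E t - lam * (E t * E t)) ->
  exists F K H, trig_kit lam S E F K H.
Proof.
move=> lam0 dS dE S0 E0 SS.
have dl t := is_derive_const (lam^-1) t; have dt t := is_derive_arg t.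
have dF t := is_deriveM_fun (is_deriveB_fun (dt t) (dS t)) (dl t).
exists (fun t => (t - S t) * lam^-1), (fun t => (2 * E t - t * S t) * lam^-1),
  (fun t => (3 * ((t - S t) * lam^-1) - S t * E t) * (2 * lam)^-1).
split=> //; rewrite ?S0 ?E0; try by ring.
- by move=> t; apply: (is_derive_eq (dF t)); field.
- move=> t; apply: (is_derive_eq (is_deriveM_fun (is_deriveB_fun
    (is_deriveM_fun (is_derive_const 2 t) (dE t))
    (is_deriveM_fun (dt t) (dS t))) (dl t))).
  by field.
- move=> t; apply: (is_derive_eq (is_deriveM_fun (is_deriveB_fun
    (is_deriveM_fun (is_derive_const 3 t) (dF t))
    (is_deriveM_fun (dS t) (dE t))) (is_derive_const ((2 * lam)^-1) t))).
  transitivity ((2 * E t + lam * (E t * E t) - S t * S t) / (2 * lam)).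
    by field.
  by rewrite SS; field.
- by move=> t; field.
- move=> t; transitivity ((2 * (1 - lam * E t) * E t - S t * S t) / lam).
    by field.
  by rewrite SS; field.
- by move=> t; field.
- by move=> t; field.
Qed.

Lemma trig_kit_pos a : a != 0 -> exists F K H,
  trig_kit (a ^+ 2) (fun t => sin (a * t) / a)
    (fun t => (1 - cos (a * t)) / a ^+ 2) F K H.
Proof.
move=> a0; refine (trig_kit_neq0 _ _ _ _ _ _).
- by rewrite expf_neq0.
- move=> t; apply: (is_derive_eq (is_deriveM_fun
    (is_derive_rescale (is_derive_sin (a * t)))
    (is_derive_const (a^-1) t))).
  by field.
- move=> t; apply: (is_derive_eq (is_deriveM_fun (is_deriveB_fun (is_derive_const 1 t)
    (is_derive_rescale (is_derive_cos (a * t)))) (is_derive_const ((a ^+ 2)^-1) t))).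
  by field.
- by rewrite mulr0 sin0 mul0r.
- by rewrite mulr0 cos0 subrr mul0r.
move=> t; transitivity (sin (a * t) ^+ 2 / a ^+ 2); first by field.
by rewrite sin2cos2; field.
Qed.

Lemma trig_kit_neg b : b != 0 -> exists F K H,
  trig_kit (- b ^+ 2) (fun t => sinh (b * t) / b)
    (fun t => (cosh (b * t) - 1) / b ^+ 2) F K H.
Proof.
move=> b0; refine (trig_kit_neq0 _ _ _ _ _ _).
- by rewrite oppr_eq0 expf_neq0.
- move=> t; apply: (is_derive_eq (is_deriveM_fun (is_derive_rescale (sinh_derive (b * t)))
    (is_derive_const (b^-1) t))).
  by field.
- move=> t; apply: (is_derive_eq (is_deriveM_fun (is_deriveB_fun
    (is_derive_rescale (cosh_derive (b * t))) (is_derive_const 1 t))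
    (is_derive_const ((b ^+ 2)^-1) t))).
  by field.
- by rewrite mulr0 /sinh oppr0 subrr !mul0r.
- by rewrite mulr0 /cosh oppr0 expR0; field.
move=> t; transitivity ((cosh (b * t) ^+ 2 - 1) / b ^+ 2); last by field.
by rewrite -(cosh2_sinh2 (b * t)); field.
Qed.

(** At [lam = 0] those relations no longer determine [F], [K], [H]; they are found by integrating
    polynomials. *)
Lemma trig_kit0 : trig_kit 0 id (fun t : R => t * t / 2)
  (fun t => t * t * t / 6) (fun t => t * t * t * t / 12)
  (fun t => t * t * t * t * t / 20).
Proof.
have d1 t := is_derive_arg t; have d2 t := is_deriveM_fun (d1 t) (d1 t).
have d3 t := is_deriveM_fun (d2 t) (d1 t); have d4 t := is_deriveM_fun (d3 t) (d1 t).
have d5 t := is_deriveM_fun (d4 t) (d1 t).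
split=> //; try by [field | move=> t; field].
- by move=> t; apply: (is_derive_eq (d1 t)); ring.
- move=> t; apply: (is_derive_eq (is_deriveM_fun (d2 t)
    (is_derive_const (2^-1) t))).
  by field.
- move=> t; apply: (is_derive_eq (is_deriveM_fun (d3 t)
    (is_derive_const (6^-1) t))).
  by field.
- move=> t; apply: (is_derive_eq (is_deriveM_fun (d4 t)
    (is_derive_const (12^-1) t))).
  by field.
- move=> t; apply: (is_derive_eq (is_deriveM_fun (d5 t)
    (is_derive_const (20^-1) t))).
  by field.
Qed.

End TrigKits.

(** * Conjugate points *)

Section ConjugacyEquations.
Variable R : realFieldType.
Implicit Types lam p T S E F K H : R.

(* [lam = (2 E - S ^ 2) / E ^ 2] turns this into an identity of rational functions
   in [S], [E], [T] and [p]. *)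
Lemma kappa_identity lam p T S E F K H : lam != 0 -> E != 0 ->
  S * S = 2 * E - lam * (E * E) -> lam * F = T - S ->
  lam * K = 2 * E - T * S -> 2 * lam * H = 3 * F - S * E ->
  let K1 := T * E - F in
  let M := S * K1 + lam * E * K in
  let N := S * K - E * K1 in
  let Q := (S * E + F) / 2 in
  let kappa := (S * K + E * K1) / 2 + Q * E - Q * M / E
    - S * E ^+ 2 / 2 + lam * N * E / 2 + H in
  lam * (T + p * F / 2 - p * kappa * lam) =
    T * (lam + p - p * (T * S / (2 * E))).
Proof.
move=> lam0 E0 SS FE KE HE /=.
have lamE : lam = (2 * E - S * S) / E ^+ 2 by rewrite SS; field.
have D0 : 2 * E - S * S != 0.
  by apply: contraNneq lam0 => D0; rewrite lamE D0 mul0r.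
have -> : F = (T - S) / lam by rewrite -FE; field.
have -> : K = (2 * E - T * S) / lam by rewrite -KE; field.
have -> : H = (3 * ((T - S) / lam) - S * E) / (2 * lam).
  by rewrite -FE -[lam * F]mulrC mulfK// -HE; field.
rewrite lamE; field.
by rewrite D0 E0.
Qed.

End ConjugacyEquations.

Section ConjugatePoints.
Variables (R : realType) (n : nat).
Local Notation V := 'rV[R]_n.
Variables (br : {bilinear V -> V -> V}) (ip : {biscalar V})
  (zz vv : {vspace V}) (nabla : {bilinear V -> V -> V}).
Hypothesis ph : pseudoH_algebra br ip zz vv nabla.
Variables (z0 x0 : V).
Hypotheses (z0_zz : z0 \in zz) (x0_vv : x0 \in vv).
Hypotheses (z0_neq0 : z0 != 0) (x0_neq0 : x0 != 0).
Variable u : R -> V.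
Hypotheses (u_geod : forall t : R, is_derive t 1 u (- nabla (u t) (u t)))
  (u0 : u 0 = z0 + x0).
Local Notation lam := (ip z0 z0).
Local Notation p := (ip x0 x0).

(** By half-angle formulas T S / (2 E) is the (a T / 2) cot (a T / 2) of [A1], or its hyperbolic
    analogue in [B1]; [kappa_identity] links it to [a = b * lam]. The second condition is [a = 0]
    multiplied by [2 * lam]. *)
Lemma nonnull_conjugate (S E F K H : R -> R) (T : R) (P1 P2 : Prop) :
  trig_kit lam S E F K H -> lam != 0 -> T != 0 -> E T != 0 ->
  (P1 <-> p * (T * S T / (2 * E T)) = lam + p) ->
  (P2 <-> (2 <= \dim zz)%N /\ (p + 2 * lam) * T = p * S T) ->
  let mult := mult_cp br nabla u T in
  [/\ conjugate_point br nabla u T <-> P1 \/ P2,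
      P1 /\ ~ P2 -> mult 1%N,
      P2 /\ ~ P1 -> mult (\dim zz - 1)%N &
      P1 /\ P2 -> mult (\dim zz)].
Proof.
move=> kit lam0 T0 E0 P1E P2E.
have FE : lam * F T = T - S T by rewrite (kit_S kit); ring.
apply: (regular_conjugate ph z0_zz x0_vv kit u_geod u0 E0 z0_neq0) => //.
  have := kappa_identity p lam0 E0 (kit_SS kit T) FE (kit_lamK kit T)
    (kit_lamH kit T).
  rewrite /= -/(kappa ip z0 S E F K H T) => kE.
  apply: (iff_trans P1E); split=> h.
    move: kE; rewrite h subrr mulr0 => /eqP.
    by rewrite mulf_eq0 (negPf lam0) subr_eq0 => /eqP.
  move: kE; rewrite h subrr mulr0 => /esym/eqP.
  by rewrite mulf_eq0 (negPf T0) subr_eq0 => /eqP.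
apply: (iff_trans P2E).
have aE : 2 * lam * (T + p * F T / 2) = (p + 2 * lam) * T - p * S T.
  by rewrite (kit_S kit); field.
have l2 : 2 * lam != 0 by rewrite mulf_neq0 ?pnatr_eq0.
split=> -[-> h]; split=> //.
  by apply: (mulfI l2); rewrite aE h subrr mulr0.
by apply/eqP; rewrite -subr_eq0 -aE h mulr0.
Qed.

Lemma singular_conjugate (S E F K H : R -> R) (T : R) :
  trig_kit lam S E F K H -> T != 0 -> E T = 0 ->
  [/\ conjugate_point br nabla u T,
      p + 2 * lam != 0 -> mult_cp br nabla u T (\dim vv - 1)%N &
      p + 2 * lam = 0 -> mult_cp br nabla u T (n - 2)%N].
Proof.
move=> kit T0 E0.
have S0 : S T = 0.
  have := kit_SS kit T; rewrite E0 !mulr0 subrr => /eqP.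
  by rewrite mulf_eq0 orbb => /eqP.
have aE : 2 * lam * (T + p * F T / 2) = (p + 2 * lam) * T.
  by rewrite -[RHS]subr0 -(mulr0 p) -S0 (kit_S kit); field.
have TF : T = lam * F T by have := kit_S kit T; rewrite S0; lra.
have lam0 : lam != 0 by apply: contraNneq T0 => lam0; rewrite TF lam0 mul0r.
have l2 : 2 * lam != 0 by rewrite mulf_neq0 ?pnatr_eq0.
have Vm := mult_vanishing ph z0_zz x0_vv kit u_geod u0 T.
(* This vector satisfies the three conditions whatever the value of [p + 2 * lam], and it is nonzero
   because [J z0] sends it to - lam x0. Hence every period gives a conjugate point. *)
have Jx : Jmap nabla z0 x0 \in vanishing br ip zz vv nabla z0 x0 S E F K H T.
  have Jv : Jmap nabla z0 x0 \in vv by rewrite (J_in ph).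
  apply/(vanishing_singular ph z0_zz x0_vv kit T0 E0 x0_neq0); split.
  - exact: (ip_orth_center ph).
  - by rewrite (ipC ph) (ip_x_Jx ph).
  - by rewrite (cproj_orth ph)// scaler0.
split.
- apply/(conjugate_vanishing ph z0_zz x0_vv kit u_geod u0).
  rewrite dimv_eq0; apply: contraNneq x0_neq0 => V0.
  move: Jx; rewrite V0 memv0 => /eqP J0.
  have := J_sqr ph z0_zz x0_vv; rewrite J0 linear0r => /esym/eqP.
  by rewrite scaler_eq0 oppr_eq0 (negPf lam0).
- move=> d0; rewrite -(dim_singular_orth ph z0_zz x0_vv kit T0 E0 x0_neq0)//.
  apply: contraNneq d0 => a0; move/eqP: aE.
  by rewrite a0 mulr0 eq_sym mulf_eq0 (negPf T0) orbF.
move=> d0; rewrite -(dim_singular_full ph z0_zz x0_vv kit T0 E0 z0_neq0 x0_neq0)//.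
by apply: (mulfI l2); rewrite aE d0 mul0r mulr0.
Qed.

Lemma null_conjugate (T : R) : lam = 0 -> T != 0 ->
  (conjugate_point br nabla u T <-> T ^+ 2 = - (12 / p)) /\
  (conjugate_point br nabla u T -> mult_cp br nabla u T (\dim zz - 1)%N).
Proof.
move=> lam0 T0; have kit := trig_kit0 R; rewrite -{1}lam0 in kit.
have E0 : T * T / 2 != 0 :> R by rewrite mulf_neq0 ?invr_eq0 ?pnatr_eq0// mulf_neq0.
have Vm := mult_vanishing ph z0_zz x0_vv kit u_geod u0 T.
have conjE := conjugate_vanishing ph z0_zz x0_vv kit u_geod u0 T.
pose a := T + p * (T * T * T / 6) / 2.
have aE : a = T * (1 + p * T ^+ 2 / 12) by rewrite /a; field.
have kE : kappa ip z0 id (fun t : R => t * t / 2) (fun t => t * t * t / 6)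
   (fun t => t * t * t * t / 12) (fun t => t * t * t * t * t / 20) T =
   - T ^+ 5 / 180.
  by rewrite /kappa lam0; field.
(* For [p = 0] the quotient [12 / p] is 0 by convention, so the equation demands [T ^+ 2 = 0] and
   fails, in accordance with the absence of conjugate points. *)
have [p0|p0] := eqVneq p 0.
  have a0 : a != 0 by rewrite aE p0 mul0r mul0r addr0 mulr1.
  have nc : ~ conjugate_point br nabla u T.
    move/conjE; rewrite (dim_regular0 ph z0_zz x0_vv kit E0)//=.
    by rewrite p0 !mul0r addr0.
  split=> //; split=> // /eqP; rewrite p0 invr0 mulr0 oppr0.
  by rewrite expf_eq0 (negPf T0).
have T2 : T ^+ 2 = - (12 / p) <-> a = 0.
  rewrite aE; split=> [->|/eqP]; first by field.
  rewrite mulf_eq0 (negPf T0) => /eqP h.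
  apply: (mulfI p0); transitivity (12 * (1 + p * T ^+ 2 / 12) - 12).
    by field.
  by rewrite h; field.
have b0 : p * kappa ip z0 id (fun t : R => t * t / 2) (fun t => t * t * t / 6)
   (fun t => t * t * t * t / 12) (fun t => t * t * t * t * t / 20) T != 0.
  by rewrite kE mulf_neq0// mulf_neq0 ?oppr_eq0 ?expf_neq0// invr_eq0 pnatr_eq0.
have [a0|a0] := eqVneq a 0; last first.
  have nc : ~ conjugate_point br nabla u T.
    move/conjE; rewrite (dim_regular0 ph z0_zz x0_vv kit E0)//=.
    by rewrite lam0 mulr0.
  by split=> //; split=> // /T2 /eqP; rewrite (negPf a0).
have dimE := dim_regular_pred ph z0_zz x0_vv kit E0 z0_neq0 a0 b0.
rewrite -dimE; split=> //; split=> _; first exact/T2.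
(* A null [z0] cannot span a nondegenerate center, so [\dim zz] is at least 2 and the multiplicity
   is positive. *)
apply/conjE; have [w wz w0] := center_witness ph z0_zz z0_neq0.
rewrite dimE subn_eq0; apply/negP => m1.
have zzE : <[z0]>%VS = zz.
  by apply/eqP; rewrite eqEdim -memvE z0_zz dim_vline z0_neq0.
move: wz w0; rewrite -zzE => /vlineP[k ->].
by rewrite (linearZl_LR ip) /= lam0 mulr0 eqxx.
Qed.

End ConjugatePoints.

(** * Conjugate points according to the sign of <z0, z0> *)

Theorem theorem2p3 (R : realType) (n : nat)
  (br : {bilinear 'rV[R]_n -> 'rV[R]_n -> 'rV[R]_n})
  (ip : {biscalar 'rV[R]_n})
  (zz vv : {vspace 'rV[R]_n})
  (nabla : {bilinear 'rV[R]_n -> 'rV[R]_n -> 'rV[R]_n})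
  (N : groupType) (e : 'rV[R]_n -> N)
  (gamma : R -> N) (u : R -> 'rV[R]_n) (z0 x0 : 'rV[R]_n) (t0 : R)
  (br_lie : lie_bracket br)
  (br_nil : two_step_nilpotent br)
  (zz_center : center_of br zz)
  (ip_inner : inner_product ip)
  (zz_nondeg : nondegenerate_on ip zz)
  (vv_orth : orthogonal_complement ip zz vv)
  (e_exp : exponential_map br e)
  (pseudoH : pseudoH_type br ip zz vv)
  (nabla_LC : levi_civita br ip nabla)
  (gamma_geod : geodesic nabla e gamma u)
  (gamma0 : gamma 0 = 1%g)
  (z0_zz : z0 \in zz) (x0_vv : x0 \in vv)
  (u0 : u 0 = z0 + x0)
  (z0_neq0 : z0 != 0) (x0_neq0 : x0 != 0)
  (normalized : ip (u 0) (u 0) != 0 ->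
     ip (u 0) (u 0) = 1 \/ ip (u 0) (u 0) = -1)
  (t0_neq0 : t0 != 0) :
  let p := ip x0 x0 in
  let g := ip (u 0) (u 0) in
  let d := g + ip z0 z0 in
  let conjugate := conjugate_point br nabla u t0 in
  let mult := mult_cp br nabla u t0 in
  [/\ forall alpha : R, 0 < alpha -> ip z0 z0 = alpha ^+ 2 ->
        let P := nonzero_multiples (2 * pi / alpha) in
        let A1 := A1 alpha p g in
        let A2 := A2 (\dim zz) alpha p d in
        [/\ conjugate <-> t0 \in P `|` A1 `|` A2,
            t0 \in P -> d != 0 -> mult (\dim vv - 1)%N,
            t0 \in P -> d = 0 -> mult (n - 2)%N &
            t0 \notin P ->
              [/\ t0 \in A1 `\` A2 -> mult 1%N,
                  t0 \in A2 `\` A1 -> mult (\dim zz - 1)%N &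
                  t0 \in A1 `&` A2 -> mult (\dim zz)]],
      forall beta : R, 0 < beta -> ip z0 z0 = - beta ^+ 2 ->
        let B1 := B1 beta p g in
        let B2 := B2 (\dim zz) beta p d in
        [/\ conjugate <-> t0 \in B1 `|` B2,
            t0 \in B1 `\` B2 -> mult 1%N,
            t0 \in B2 `\` B1 -> mult (\dim zz - 1)%N &
            t0 \in B1 `&` B2 -> mult (\dim zz)] &
      ip z0 z0 = 0 ->
        (conjugate <-> t0 ^+ 2 = - (12 / p)) /\
        (conjugate -> mult (\dim zz - 1)%N)].
Proof.
move=> p g d conjugate mult.
have ph : pseudoH_algebra br ip zz vv nabla by split.
have u_geod (t : R) : is_derive t 1 u (- nabla (u t) (u t)).
  have [_ du geod] := gamma_geod; split; first exact: du.
  by apply/eqP; rewrite -addr_eq0; apply/eqP; exact: geod.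
have gE : g = ip z0 z0 + p.
  rewrite /g u0 (linearDl ip) !(linearDr ip) /=.
  by rewrite (ip_center_orth ph z0_zz x0_vv) (ip_orth_center ph z0_zz x0_vv) add0r addr0.
have dE : d = p + 2 * ip z0 z0 by rewrite /d gE; ring.
(* With the denominator cleared, both branches of [eq_ratio] become the same equation. *)
have ratioE (s f : R) : ip z0 z0 != 0 -> s != 0 -> eq_ratio s p d f <-> d * s = p * f.
  move=> lam0 s0; rewrite /eq_ratio; have [d0|d0] := eqVneq d 0.
    by rewrite d0 mul0r; split.
  by split=> [->|h]; [field | apply: (mulfI d0); rewrite h; field].
split=> [alpha alpha0 lamE P A1 A2|beta beta0 lamE B1 B2|lam0]; last first.
- exact: (null_conjugate ph z0_zz x0_vv z0_neq0 u_geod u0).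
- have b0 : beta != 0 by rewrite gt_eqF.
  have lam0 : ip z0 z0 != 0 by rewrite lamE oppr_eq0 expf_neq0.
  have [F [K [H kit]]] := trig_kit_neg b0; rewrite -lamE in kit.
  pose c := beta * t0 / 2.
  have tE : beta * t0 = 2 * c by rewrite /c; field.
  have t1 : beta * t0 != 0 by rewrite mulf_neq0.
  (* The hyperbolic sine vanishes only at 0, so there are no periods in this case. *)
  have sc : sinh c != 0.
    by rewrite sinh_eq0 /c mulf_neq0 ?invr_eq0 ?pnatr_eq0.
  have EE : (cosh (beta * t0) - 1) / beta ^+ 2 = 2 * sinh c ^+ 2 / beta ^+ 2.
    by rewrite tE cosh_double; ring.
  have E0 : (cosh (beta * t0) - 1) / beta ^+ 2 != 0.
    by rewrite EE mulf_neq0 ?invr_eq0 ?expf_neq0// mulf_neq0 ?expf_neq0 ?pnatr_eq0.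
  have B1E : B1 t0 <-> p * (t0 * (sinh (beta * t0) / beta) /
      (2 * ((cosh (beta * t0) - 1) / beta ^+ 2))) = ip z0 z0 + p.
    rewrite -gE EE tE sinh_double /B1 /Defs.B1 /= -/c /coth.
    rewrite (_ : t0 * _ / _ = c * (cosh c / sinh c)); last first.
      by rewrite /c; field; rewrite sc b0.
    by split=> [[]|].
  have B2E : B2 t0 <-> (2 <= \dim zz)%N /\ (p + 2 * ip z0 z0) * t0 =
      p * (sinh (beta * t0) / beta).
    rewrite /B2 /Defs.B2 /=.
    split=> -[-> h]; split=> //; last first.
      by apply/ratioE => //; rewrite dE mulrCA h; field.
    move/(ratioE _ _ lam0 t1): h; rewrite dE => h.
    by apply: (mulfI b0); rewrite mulrCA h; field.
  have [cE m1 m2 m3] := nonnull_conjugate ph z0_zz x0_vv z0_neq0 u_geod u0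
     kit lam0 t0_neq0 E0 B1E B2E.
  by rewrite !in_setE.
have a0 : alpha != 0 by rewrite gt_eqF.
have lam0 : ip z0 z0 != 0 by rewrite lamE expf_neq0.
have [F [K [H kit]]] := trig_kit_pos a0; rewrite -{1}lamE in kit.
pose c := alpha * t0 / 2.
have tE : alpha * t0 = 2 * c by rewrite /c; field.
have t1 : alpha * t0 != 0 by rewrite mulf_neq0.
have EE : (1 - cos (alpha * t0)) / alpha ^+ 2 = 2 * sin c ^+ 2 / alpha ^+ 2.
  by rewrite tE cos_double; ring.
(* In terms of the half angle [c] the periods are the zeros of the sine; the index [k] is nonzero
   because [t0] is. *)
have PE : P t0 <-> sin c = 0.
  apply: (iff_trans _ (iff_sym (sin_eq0P c))).
  split=> [[k k0 tk]|[k cE]].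
    by exists k; rewrite /c -tk; field.
  have tk : 2 * pi / alpha * k%:~R = t0.
    by rewrite -[RHS](mulKf a0) tE cE; field.
  by exists k => //=; apply: contraNneq t0_neq0 => k0; rewrite -tk k0 mulr0.
have [s0|s0] := eqVneq (sin c) 0.
  have E0 : (1 - cos (alpha * t0)) / alpha ^+ 2 = 0.
    by rewrite EE s0 expr0n mulr0 mul0r.
  have [cj m1 m2] := singular_conjugate ph z0_zz x0_vv z0_neq0 x0_neq0 u_geod u0
    kit t0_neq0 E0.
  have Pt : P t0 by apply/PE.
  rewrite !in_setE dE; split=> //; first by split=> // _; left; left.
  by move/negP; rewrite in_setE.
have nP : ~ P t0 by move/PE/eqP; rewrite (negPf s0).
have E0 : (1 - cos (alpha * t0)) / alpha ^+ 2 != 0.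
  by rewrite EE mulf_neq0 ?invr_eq0 ?expf_neq0// mulf_neq0 ?expf_neq0 ?pnatr_eq0.
have A1E : A1 t0 <-> p * (t0 * (sin (alpha * t0) / alpha) /
    (2 * ((1 - cos (alpha * t0)) / alpha ^+ 2))) = ip z0 z0 + p.
  rewrite -gE EE tE sin_double /A1 /Defs.A1 /= -/c /cot.
  rewrite (_ : t0 * _ / _ = c * (cos c / sin c)); last first.
    by rewrite /c; field; rewrite s0 a0.
  by split=> [[]|].
have A2E : A2 t0 <-> (2 <= \dim zz)%N /\ (p + 2 * ip z0 z0) * t0 =
    p * (sin (alpha * t0) / alpha).
  rewrite /A2 /Defs.A2 /=.
  split=> -[-> h]; split=> //; last first.
    by apply/ratioE => //; rewrite dE mulrCA h; field.
  move/(ratioE _ _ lam0 t1): h; rewrite dE => h.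
  by apply: (mulfI a0); rewrite mulrCA h; field.
have [cE m1 m2 m3] := nonnull_conjugate ph z0_zz x0_vv z0_neq0 u_geod u0
   kit lam0 t0_neq0 E0 A1E A2E.
rewrite !in_setE; split=> //.
by apply: (iff_trans cE); split=> [[]|[[]|]]; [left; right|right| |left|right].
Qed.
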